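(* Over $\mathbf{ACA}_0$, being a complete countable metric space is a $\Pi^1_1$ universal formula.
   Context: All notions are formalized in second order arithmetic. Countable metric space: a pair $(X,d)$ with $X\subseteq\mathbb{N}$ and $d:X\times X\to\mathbb{R}$ a metric (reals coded as usual by rapidly converging sequences of rationals). It is complete if every Cauchy sequence of points of $X$ converges to a point of $X$ (countable metric spaces are taken as they are, not as codes for their completions). A property $P$ of objects coded by sets is $\Pi^1_1$ universal over $\mathbf{ACA}_0$ if $\mathbf{ACA}_0$ proves $P$ equivalent to a $\Pi^1_1$ formula, and for every $\Pi^1_1$ formula $\varphi(Z)$ there is an arithmetical definition of an object $M_Z$ from $Z$ such that $\mathbf{ACA}_0$ proves $\forall Z\,(\varphi(Z)\leftrightarrow P(M_Z))$. *)

(* Defs.v *)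
From Stdlib Require Import List Arith.
Import ListNotations.

Set Implicit Arguments.
Unset Strict Implicit.
Unset Printing Implicit Defensive.

(** * Second-order arithmetic *)

(** Syntax of the two-sorted language with 0, 1, +, *, <, = on numbers and
    membership.  Binding is by de Bruijn indices, counted separately for the
    number variables ([tvar], bound by [alln]) and the set variables (bound by
    [alls]).  As usual there is no primitive equality between sets. *)

Inductive term : Type :=
| tvar (n : nat)
| tzero
| tone
| tadd (s t : term)
| tmul (s t : term).

Inductive form : Type :=
| feq (s t : term)
| flt (s t : term)
| fmem (t : term) (X : nat)
| fbot
| fimp (A B : form)
| alln (A : form)
| alls (A : form).

Definition fneg (A : form) : form := fimp A fbot.
Definition fand (A B : form) : form := fneg (fimp A (fneg B)).
Definition for_ (A B : form) : form := fimp (fneg A) B.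
Definition fiff (A B : form) : form := fand (fimp A B) (fimp B A).
Definition exn (A : form) : form := fneg (alln (fneg A)).
Definition exs (A : form) : form := fneg (alls (fneg A)).

Fixpoint tsubst (s : nat -> term) (t : term) : term :=
  match t with
  | tvar n => s n
  | tzero => tzero
  | tone => tone
  | tadd a b => tadd (tsubst s a) (tsubst s b)
  | tmul a b => tmul (tsubst s a) (tsubst s b)
  end.

Definition scons (T : Type) (x : T) (s : nat -> T) (n : nat) : T :=
  match n with 0 => x | S m => s m end.

Definition upn (s : nat -> term) : nat -> term :=
  scons (tvar 0) (fun n => tsubst (fun m => tvar (S m)) (s n)).

Definition ups (r : nat -> nat) : nat -> nat := scons 0 (fun n => S (r n)).

(** Simultaneous substitution of terms [s] for the number variables and of
    set variables [r] for the set variables. *)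
Fixpoint subst (s : nat -> term) (r : nat -> nat) (A : form) : form :=
  match A with
  | feq a b => feq (tsubst s a) (tsubst s b)
  | flt a b => flt (tsubst s a) (tsubst s b)
  | fmem a X => fmem (tsubst s a) (r X)
  | fbot => fbot
  | fimp B C => fimp (subst s r B) (subst s r C)
  | alln B => alln (subst (upn s) r B)
  | alls B => alls (subst s (ups r) B)
  end.

Definition id_set : nat -> nat := fun X => X.
Definition shiftn (A : form) : form := subst (fun n => tvar (S n)) id_set A.
Definition shifts (A : form) : form := subst tvar S A.
Definition instn (A : form) (t : term) : form := subst (scons t tvar) id_set A.
Definition insts (A : form) (X : nat) : form := subst tvar (scons X id_set) A.

(** [tbound n t]: the variables of [t] are among the first [n];
    [closed n m A]: the free number variables of [A] are among the first [n]
    and its free set variables among the first [m]. *)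
Fixpoint tbound (n : nat) (t : term) : Prop :=
  match t with
  | tvar k => k < n
  | tzero | tone => True
  | tadd a b | tmul a b => tbound n a /\ tbound n b
  end.

Fixpoint closed (n m : nat) (A : form) : Prop :=
  match A with
  | feq a b | flt a b => tbound n a /\ tbound n b
  | fmem a X => tbound n a /\ X < m
  | fbot => True
  | fimp B C => closed n m B /\ closed n m C
  | alln B => closed (S n) m B
  | alls B => closed n (S m) B
  end.

Fixpoint arithmetical (A : form) : Prop :=
  match A with
  | feq _ _ | flt _ _ | fmem _ _ | fbot => True
  | fimp B C => arithmetical B /\ arithmetical C
  | alln B => arithmetical B
  | alls _ => False
  end.

Definition Pi11 (A : form) : Prop :=
  exists B, arithmetical B /\ A = alls B.

(** Classical natural deduction with axioms [T].  An axiom may be used in any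
    context, so its free variables are read as universally quantified. *)
Inductive prf (T : form -> Prop) : list form -> form -> Prop :=
| prf_hyp G A : In A G -> prf T G A
| prf_ax G A : T A -> prf T G A
| prf_impI G A B : prf T (A :: G) B -> prf T G (fimp A B)
| prf_impE G A B : prf T G (fimp A B) -> prf T G A -> prf T G B
| prf_raa G A : prf T (fneg A :: G) fbot -> prf T G A
| prf_allnI G A : prf T (map shiftn G) A -> prf T G (alln A)
| prf_allnE G A t : prf T G (alln A) -> prf T G (instn A t)
| prf_allsI G A : prf T (map shifts G) A -> prf T G (alls A)
| prf_allsE G A X : prf T G (alls A) -> prf T G (insts A X)
| prf_refl G t : prf T G (feq t t)
| prf_leibniz G A s t :
    prf T G (feq s t) -> prf T G (instn A s) -> prf T G (instn A t).

Definition provable (T : form -> Prop) (A : form) : Prop := prf T [] A.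

(** * Formulas with named bound variables

    An [nexp] is a number term, an [sexp] a set variable and an [fexp] a
    formula, each as a function of the number of enclosing quantifiers (number
    quantifiers for [nexp], set quantifiers for [sexp], both for [fexp]).  A
    variable bound under [d] quantifiers of its sort is, under [d'] of them,
    the de Bruijn index [d' - S d]; quantifiers can thus bind Rocq variables. *)

Definition nexp := nat -> term.
Definition sexp := nat -> nat.
Definition fexp := nat -> nat -> form.

Definition nzero : nexp := fun _ => tzero.
Definition none_ : nexp := fun _ => tone.
Definition nadd (s t : nexp) : nexp := fun d => tadd (s d) (t d).
Definition nmul (s t : nexp) : nexp := fun d => tmul (s d) (t d).

Definition xeq (s t : nexp) : fexp := fun d _ => feq (s d) (t d).
Definition xlt (s t : nexp) : fexp := fun d _ => flt (s d) (t d).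
Definition xmem (t : nexp) (X : sexp) : fexp := fun d e => fmem (t d) (X e).
Definition xneg (A : fexp) : fexp := fun d e => fneg (A d e).
Definition ximp (A B : fexp) : fexp := fun d e => fimp (A d e) (B d e).
Definition xand (A B : fexp) : fexp := fun d e => fand (A d e) (B d e).
Definition xor_ (A B : fexp) : fexp := fun d e => for_ (A d e) (B d e).
Definition xiff (A B : fexp) : fexp := fun d e => fiff (A d e) (B d e).
Definition xalln (F : nexp -> fexp) : fexp :=
  fun d e => alln (F (fun d' => tvar (d' - S d)) (S d) e).
Definition xexn (F : nexp -> fexp) : fexp :=
  fun d e => exn (F (fun d' => tvar (d' - S d)) (S d) e).
Definition xalls (F : sexp -> fexp) : fexp :=
  fun d e => alls (F (fun e' => e' - S e) d (S e)).
Definition xexs (F : sexp -> fexp) : fexp :=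
  fun d e => exs (F (fun e' => e' - S e) d (S e)).

Definition sentence (A : fexp) : form := A 0 0.

(** The formula whose only free variable is the set variable 0. *)
Definition set_formula (F : sexp -> fexp) : form := F (fun e => e) 0 0.

Declare Scope so_scope.
Delimit Scope so_scope with so.

Module SONotations.

Notation "0" := nzero : so_scope.
Notation "1" := none_ : so_scope.
Notation "2" := (nadd none_ none_) : so_scope.
Notation "s + t" := (nadd s t) : so_scope.
Notation "s * t" := (nmul s t) : so_scope.
Notation "s == t" := (xeq s t) (at level 70, no associativity) : so_scope.
Notation "s < t" := (xlt s t) : so_scope.
Notation "s <= t" := (xor_ (xlt s t) (xeq s t)) : so_scope.
Notation "t \in X" := (xmem t X) (at level 70, no associativity) : so_scope.
Notation "~ A" := (xneg A) : so_scope.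
Notation "A /\ B" := (xand A B) : so_scope.
Notation "A \/ B" := (xor_ A B) : so_scope.
Notation "A ==> B" := (ximp A B) (at level 90, right associativity) : so_scope.
Notation "A <==> B" := (xiff A B) (at level 95, no associativity) : so_scope.
Notation "'all' x .. y , A" :=
  (xalln (fun x => .. (xalln (fun y => A)) ..))
  (at level 200, x binder, y binder, right associativity) : so_scope.
Notation "'some' x .. y , A" :=
  (xexn (fun x => .. (xexn (fun y => A)) ..))
  (at level 200, x binder, y binder, right associativity) : so_scope.
Notation "'allset' X , A" := (xalls (fun X => A))
  (at level 200, X name, right associativity) : so_scope.

End SONotations.

Import SONotations.

(** * The axioms of ACA_0 *)

Inductive ACA0 : form -> Prop :=
| aca_succ_neq0 : ACA0 (sentence (all n, ~ (n + 1 == 0))%so)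
| aca_succ_inj : ACA0 (sentence (all m n, m + 1 == n + 1 ==> m == n)%so)
| aca_add0 : ACA0 (sentence (all m, m + 0 == m)%so)
| aca_addS : ACA0 (sentence (all m n, m + (n + 1) == (m + n) + 1)%so)
| aca_mul0 : ACA0 (sentence (all m, m * 0 == 0)%so)
| aca_mulS : ACA0 (sentence (all m n, m * (n + 1) == m * n + m)%so)
| aca_lt0 : ACA0 (sentence (all m, ~ (m < 0))%so)
| aca_ltS :
    ACA0 (sentence (all m n, m < n + 1 <==> (m < n \/ m == n))%so)
| aca_induction :
    ACA0 (sentence (allset X,
      (0 \in X /\ (all n, n \in X ==> n + 1 \in X)) ==> all n, n \in X)%so)
(* Comprehension for [A]; number variable 0 of [A] is the element, and the
   shift keeps the new set from occurring in [A]. *)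
| aca_comprehension A : arithmetical A ->
    ACA0 (exs (alln (fiff (fmem (tvar 0) 0) (shifts A)))).

(** * Pi^1_1 universality over ACA_0

    [Obj] and [P] are formulas whose only free variable is set variable 0:
    [Obj] says that the set codes an object, [P] is the property.  In the
    second part [D] has the free variables n (number variable 0) and Z (set
    variable 0), and defines M_Z as the set of the n with D(n, Z). *)
Definition Pi11_universal (Obj P : form) : Prop :=
  (exists Q, Pi11 Q /\ closed 0 1 Q /\
     provable ACA0 (alls (fiff (fand Obj P) Q)))
  /\
  (forall A, Pi11 A -> closed 0 1 A ->
     exists D, arithmetical D /\ closed 1 1 D /\
       provable ACA0
         (alls (exs (fand (alln (fiff (fmem (tvar 0) 0) (shifts D)))
                          (fand Obj (fiff (shifts A) P)))))).

(** * Rational and real numbers in second-order arithmetic *)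

Open Scope so_scope.

(** Injective pairing. *)
Definition npair (s t : nexp) : nexp := (s + t) * (s + t) + s.

(** [beta a b i r]: r is the remainder of a modulo 1 + (i+1)b. *)
Definition beta (a b i r : nexp) : fexp :=
  r < 1 + (i + 1) * b /\ some q, a == q * (1 + (i + 1) * b) + r.

(** 2^k = y, the powers being listed by Goedel's beta function. *)
Definition pow2 (k y : nexp) : fexp :=
  some a b,
    beta a b 0 1 /\
    (all i r, i < k ==> beta a b i r ==> beta a b (i + 1) (2 * r)) /\
    beta a b k y.

(** The rational (pos - neg) / den; it is only used with den > 0.  A rational
    has several codes. *)
Record rat := Rat { pos : nexp; neg : nexp; den : nexp }.

Definition rcode (p : rat) : nexp := npair (npair (pos p) (neg p)) (den p).

Definition allrat (F : rat -> fexp) : fexp :=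
  all a b c, 0 < c ==> F (Rat a b c).
Definition somerat (F : rat -> fexp) : fexp :=
  some a b c, 0 < c /\ F (Rat a b c).

Definition rzero : rat := Rat 0 0 1.
Definition radd (p q : rat) : rat :=
  Rat (pos p * den q + pos q * den p) (neg p * den q + neg q * den p)
      (den p * den q).
Definition ropp (p : rat) : rat := Rat (neg p) (pos p) (den p).
Definition rle (p q : rat) : fexp :=
  pos p * den q + neg q * den p <= pos q * den p + neg p * den q.
Definition rpos (p : rat) : fexp := neg p < pos p.

(** |p - q| <= e *)
Definition rclose (p q e : rat) : fexp :=
  rle p (radd q e) /\ rle q (radd p e).

(** A real is a sequence of rationals, given by its graph. *)
Definition real := nexp -> rat -> fexp.

Definition is_real (R : real) : fexp :=
  (all k, somerat (fun p => R k p)) /\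
  (all k, allrat (fun p => allrat (fun q =>
     R k p /\ R k q ==> rcode p == rcode q))) /\
  (all k i u, allrat (fun p => allrat (fun q =>
     pow2 k u /\ R k p /\ R (k + i) q ==> rclose p q (Rat 1 0 u)))).

Definition real_of_rat (p : rat) : real := fun _ q => rcode q == rcode p.

(** The k-th term of a sum is the sum of the terms of index k + 1. *)
Definition real_add (R S : real) : real := fun k r =>
  somerat (fun p => somerat (fun q =>
    R (k + 1) p /\ S (k + 1) q /\ rcode r == rcode (radd p q))).

(** In terms of the sequences, the bound in = and <= is 2 / 2^k. *)
Definition real_eq (R S : real) : fexp :=
  all k u, allrat (fun p => allrat (fun q =>
    pow2 k u /\ R k p /\ S k q ==> rclose p q (Rat 2 0 u))).
Definition real_le (R S : real) : fexp :=
  all k u, allrat (fun p => allrat (fun q =>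
    pow2 k u /\ R k p /\ S k q ==> rle p (radd q (Rat 2 0 u)))).
Definition real_lt (R S : real) : fexp := ~ real_le S R.

(** * Countable metric spaces

    A set M codes the pair (X, d) of sets with
    M = {2x | x in X} U {2z + 1 | z in d}; here d is the graph, as a set of
    pairs (((x, y), k), q), of the function sending x, y in X and k to the k-th
    rational of the real d(x, y). *)

Definition space (M : sexp) (x : nexp) : fexp := x + x \in M.

Definition dist (M : sexp) (x y : nexp) : real := fun k q =>
  let z := npair (npair (npair x y) k) (rcode q) in z + z + 1 \in M.

Definition metric_space_exp (M : sexp) : fexp :=
  (all z, z + z + 1 \in M ==>
     some x y k, somerat (fun q =>
       space M x /\ space M y /\
       z == npair (npair (npair x y) k) (rcode q))) /\
  (all x y, space M x /\ space M y ==> is_real (dist M x y)) /\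
  (all x y, space M x /\ space M y ==>
     real_le (real_of_rat rzero) (dist M x y)) /\
  (all x y, space M x /\ space M y ==>
     (real_eq (dist M x y) (real_of_rat rzero) <==> x == y)) /\
  (all x y, space M x /\ space M y ==>
     real_eq (dist M x y) (dist M y x)) /\
  (all x y z, space M x /\ space M y /\ space M z ==>
     real_le (dist M x z) (real_add (dist M x y) (dist M y z))).

(** S is (the graph of) a function from N to the points of M. *)
Definition is_sequence (M S : sexp) : fexp :=
  (all z, z \in S ==> some n x, space M x /\ z == npair n x) /\
  (all n, some x, npair n x \in S) /\
  (all n x y, npair n x \in S /\ npair n y \in S ==> x == y).

Definition is_cauchy (M S : sexp) : fexp :=
  allrat (fun e => rpos e ==>
    some N, all m n x y,
      N <= m /\ N <= n /\ npair m x \in S /\ npair n y \in S ==>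
      real_lt (dist M x y) (real_of_rat e)).

Definition converges_to (M S : sexp) (l : nexp) : fexp :=
  allrat (fun e => rpos e ==>
    some N, all n x, N <= n /\ npair n x \in S ==>
      real_lt (dist M x l) (real_of_rat e)).

Definition complete_exp (M : sexp) : fexp :=
  allset S, is_sequence M S /\ is_cauchy M S ==>
    some l, space M l /\ converges_to M S l.

Close Scope so_scope.

Definition countable_metric_space : form := set_formula metric_space_exp.
Definition complete : form := set_formula complete_exp.

Lemma closed_countable_metric_space : closed 0 1 countable_metric_space.
Proof. cbv; repeat split; auto 60 with arith. Qed.

Lemma arithmetical_countable_metric_space :
  arithmetical countable_metric_space.
Proof. cbv; repeat split. Qed.

Lemma closed_complete : closed 0 1 complete.
Proof. cbv; repeat split; auto 60 with arith. Qed.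

(* Main.v *)
(** A formula is provable as soon as it holds in all structures satisfying the
    axioms (completeness of natural deduction, by a Henkin construction in
    which free variables serve as witnesses), so that the proof is carried out
    inside an arbitrary model of ACA_0.

    Let [A(Z)] be [forall X, B(X, Z)] with [B] arithmetical.  A counterexample
    [X] amounts to a function f that lists the truth values of the subformulas
    of [B], with a counterexample for each false universal one; being such an
    f is a condition on all triples of values of f.  The points of M_Z are the
    finite sequences satisfying this condition, and the distance of two
    distinct points is 1/k for the least k such that they do not agree up to k.
    Every point is isolated, so a Cauchy sequence either is eventually constant
    or has longer and longer terms that converge to an infinite f as above.
    Hence M_Z is complete exactly if there is no such f. *)

(* The matrix [B] may contain number quantifiers, so it cannot be tested on finite sequences
   directly. Listing truth values together with counterexamples makes the test local: an implication
   concerns its own value and those of its two sides, hence three entries of f, and no other clause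
   concerns more; a universal formula is tested one instance at a time. Since X is itself read off
   f, the relation defining the points has Z as its only set variable. Conversely, f has to be
   obtained as a set from X. Taking least counterexamples makes f arithmetically definable from X
   and Z, which brings it within arithmetical comprehension. The models may be nonstandard. The
   subformulas of [B] form an actual finite list, but lengths, codes and distances are elements of
   the model, so the beta function lemma is derived inside it. Two points can agree at most up to
   the shorter of their lengths. This isolates every point, even though one sequence has several
   codes: two codes of a sequence of length n are at distance 1/(n + 1). *)
Require Import Defs.

Set Implicit Arguments.
Unset Strict Implicit.
Unset Printing Implicit Defensive.

(* A module, since the notations clash with those of [Setoid]. *)
Module SpaceFormula.

Import SONotations.
Open Scope so_scope.

(** * The formula that defines the space *)

Section Relation.
Variable rho : form.

(* The point ((a, b), n) stands for the sequence of length n that the beta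
   function reads off (a, b); different points may have the same sequence.
   It is required that every three of its entries satisfy [rho], whose
   variables 0, ..., 5 are the positions and the values i1, y1, i2, y2, i3, y3. *)
Definition node_exp (x : nexp) : fexp :=
  some a b n, x == npair (npair a b) n /\
    all y3 i3 y2 i2 y1 i1,
      i1 < n /\ beta a b i1 y1 /\ i2 < n /\ beta a b i2 y2 /\
      i3 < n /\ beta a b i3 y3 ==> (fun _ _ => rho).

(** The bounds on [k] make a point of length n disagree at n + 1 with every point, itself included.
    Hence all other points are at distance at least 1/(n + 1) from it. *)
Definition agree_exp (x y k : nexp) : fexp :=
  some a b n a' b' n',
    x == npair (npair a b) n /\ y == npair (npair a' b') n' /\
    k <= n /\ k <= n' /\
    all i v, i < k ==> (beta a b i v <==> beta a' b' i v).

Definition separation_exp (x y k : nexp) : fexp :=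
  ~ agree_exp x y k /\ all j, j < k ==> agree_exp x y j.

(** Equality needs its own case: a point fails to agree with itself beyond its length, so separation
    alone would give it a positive distance from itself. *)
Definition distance_exp (x y q : nexp) : fexp :=
  (x == y /\ q == rcode rzero) \/
  (~ x == y /\ some k, separation_exp x y k /\ q == rcode (Rat 1 0 k)).

(** The index [k] of the approximation is unrestricted, so each distance is a constant sequence of
    rationals. *)
Definition space_exp (w : nexp) : fexp :=
  (some x, w == x + x /\ node_exp x) \/
  (some x y k q, w == npair (npair (npair x y) k) q
                      + npair (npair (npair x y) k) q + 1 /\
     node_exp x /\ node_exp y /\ distance_exp x y q).

Definition space_form : form := space_exp (fun d => tvar d) 0%nat 0%nat.

End Relation.
End SpaceFormula.

From Stdlib Require Import List Arith Lia Cantor Ring Setoid.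
From Stdlib Require Import Classical ClassicalEpsilon FunctionalExtensionality PropExtensionality.
Import ListNotations.

(** * Substitution *)

Lemma tsubst_comp s s' t :
  tsubst s' (tsubst s t) = tsubst (fun n => tsubst s' (s n)) t.
Proof. induction t; cbn; congruence. Qed.

Lemma tsubst_id t : tsubst tvar t = t.
Proof. induction t; cbn; congruence. Qed.

Lemma upn_comp s s' :
  (fun n => tsubst (upn s') (upn s n)) = upn (fun n => tsubst s' (s n)).
Proof.
  apply functional_extensionality; intros [|n]; [reflexivity|].
  cbn; now rewrite !tsubst_comp.
Qed.

Lemma upn_id : upn tvar = tvar.
Proof. now apply functional_extensionality; intros [|n]. Qed.

Lemma ups_comp r r' : (fun X => ups r' (ups r X)) = ups (fun X => r' (r X)).
Proof. now apply functional_extensionality; intros [|n]. Qed.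

Lemma ups_id : ups (fun X => X) = (fun X => X).
Proof. now apply functional_extensionality; intros [|n]. Qed.

Lemma subst_comp A : forall s r s' r',
  subst s' r' (subst s r A)
  = subst (fun n => tsubst s' (s n)) (fun X => r' (r X)) A.
Proof.
  induction A; intros; cbn; rewrite ?tsubst_comp; try reflexivity.
  - now rewrite IHA1, IHA2.
  - now rewrite IHA, upn_comp.
  - now rewrite IHA, ups_comp.
Qed.

Lemma subst_id A : subst tvar (fun X => X) A = A.
Proof.
  induction A; cbn; rewrite ?tsubst_id, ?upn_id, ?ups_id; congruence.
Qed.

Lemma subst_shiftn s r A :
  subst (upn s) r (shiftn A) = shiftn (subst s r A).
Proof. unfold shiftn; now rewrite !subst_comp. Qed.

Lemma subst_shifts s r A :
  subst s (ups r) (shifts A) = shifts (subst s r A).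
Proof.
  unfold shifts; rewrite !subst_comp; f_equal.
  apply functional_extensionality; intro n; cbn; now rewrite tsubst_id.
Qed.

Lemma subst_upn_scons s r r' t A :
  subst (scons t tvar) r' (subst (upn s) r A)
  = subst (scons t s) (fun X => r' (r X)) A.
Proof.
  rewrite subst_comp; f_equal.
  apply functional_extensionality; intros [|n]; [reflexivity|].
  cbn; now rewrite tsubst_comp, tsubst_id.
Qed.

Lemma instn_subst s r t A :
  instn (subst (upn s) r A) t = subst (scons t s) r A.
Proof. exact (subst_upn_scons s r id_set t A). Qed.

Lemma insts_subst s r X A :
  insts (subst s (ups r) A) X = subst s (scons X r) A.
Proof.
  unfold insts; rewrite subst_comp; f_equal;
    apply functional_extensionality; intro n.
  - apply tsubst_id.
  - now destruct n.
Qed.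

Lemma subst_instn s r t A :
  subst s r (instn A t) = instn (subst (upn s) r A) (tsubst s t).
Proof.
  rewrite instn_subst; unfold instn; rewrite subst_comp; f_equal.
  now apply functional_extensionality; intros [|n].
Qed.

Lemma subst_insts s r X A :
  subst s r (insts A X) = insts (subst s (ups r) A) (r X).
Proof.
  rewrite insts_subst; unfold insts; rewrite subst_comp; f_equal.
  now apply functional_extensionality; intros [|n].
Qed.

Lemma tsubst_tbound n t s s' :
  tbound n t -> (forall k, k < n -> s k = s' k) -> tsubst s t = tsubst s' t.
Proof.
  induction t; cbn; intros H E; auto; destruct H; now rewrite IHt1, IHt2.
Qed.

Lemma subst_closed A : forall n m s s' r r',
  closed n m A -> (forall k, k < n -> s k = s' k) ->
  (forall X, X < m -> r X = r' X) -> subst s r A = subst s' r' A.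
Proof.
  induction A; cbn; intros n0 m s1 s2 r r' H E F.
  - destruct H; f_equal; eapply tsubst_tbound; eauto.
  - destruct H; f_equal; eapply tsubst_tbound; eauto.
  - destruct H; f_equal; [eapply tsubst_tbound; eauto | auto].
  - reflexivity.
  - destruct H; f_equal; eauto.
  - f_equal; apply IHA with (n := S n0) (m := m); auto.
    intros [|k] Hk; [reflexivity|]; cbn; rewrite E by lia; reflexivity.
  - f_equal; apply IHA with (n := n0) (m := S m); auto.
    intros [|k] Hk; [reflexivity|]; cbn; rewrite F by lia; reflexivity.
Qed.

Lemma tbound_mono n n' t : n <= n' -> tbound n t -> tbound n' t.
Proof. induction t; cbn; intuition lia. Qed.

Lemma closed_mono A : forall n n' m m',
  n <= n' -> m <= m' -> closed n m A -> closed n' m' A.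
Proof.
  induction A; cbn; intros n0 n' m m' Hn Hm H;
    try (destruct H; split; eauto using tbound_mono; lia); auto.
  - revert H; apply IHA; lia.
  - revert H; apply IHA; lia.
Qed.

Lemma tbound_ex t : exists n, tbound n t.
Proof.
  induction t; cbn.
  - exists (S n); lia.
  - now exists 0.
  - now exists 0.
  - destruct IHt1 as [n1 H1], IHt2 as [n2 H2]; exists (max n1 n2).
    split; (eapply tbound_mono; [|eassumption]); lia.
  - destruct IHt1 as [n1 H1], IHt2 as [n2 H2]; exists (max n1 n2).
    split; (eapply tbound_mono; [|eassumption]); lia.
Qed.

Lemma closed_ex A : exists n, closed n n A.
Proof.
  induction A; cbn.
  - destruct (tbound_ex s) as [n1 H1], (tbound_ex t) as [n2 H2].
    exists (max n1 n2); split; (eapply tbound_mono; [|eassumption]); lia.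
  - destruct (tbound_ex s) as [n1 H1], (tbound_ex t) as [n2 H2].
    exists (max n1 n2); split; (eapply tbound_mono; [|eassumption]); lia.
  - destruct (tbound_ex t) as [n1 H1]; exists (max n1 (S X)); split; [|lia].
    (eapply tbound_mono; [|eassumption]); lia.
  - now exists 0.
  - destruct IHA1 as [n1 H1], IHA2 as [n2 H2]; exists (max n1 n2).
    split; (eapply closed_mono; [| |eassumption]); lia.
  - destruct IHA as [n H]; exists n; (eapply closed_mono; [| |eassumption]); lia.
  - destruct IHA as [n H]; exists n; (eapply closed_mono; [| |eassumption]); lia.
Qed.

(** Such a bound is itself a variable that is fresh for the whole context, in both sorts. *)
Lemma closed_ctx_ex G : exists n, forall A, In A G -> closed n n A.
Proof.
  induction G as [|B G [n1 H1]]; [exists 0; intros A []|].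
  destruct (closed_ex B) as [n2 H2]; exists (max n1 n2).
  intros A [<-|H]; (eapply closed_mono; [| |eauto]); lia.
Qed.

Lemma arithmetical_subst A : forall s r,
  arithmetical A -> arithmetical (subst s r A).
Proof. induction A; cbn; intuition. Qed.

(** * Derivations *)

(** Axioms may have free variables and be used in any context, so renaming variables in a derivation
    must carry axioms to axioms. *)
Definition subst_stable (T : form -> Prop) : Prop :=
  forall A s r, T A -> T (subst s r A).

Lemma prf_subst T G A :
  subst_stable T -> prf T G A ->
  forall s r, prf T (map (subst s r) G) (subst s r A).
Proof.
  intros HT; induction 1; intros s0 r0; cbn in *.
  - now apply prf_hyp, in_map.
  - now apply prf_ax, HT.
  - apply prf_impI, IHprf.
  - eapply prf_impE; [apply IHprf1 | apply IHprf2].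
  - apply prf_raa, IHprf.
  - apply prf_allnI; specialize (IHprf (upn s0) r0).
    rewrite map_map in *; erewrite map_ext; [exact IHprf|].
    intro B; cbn; now rewrite subst_shiftn.
  - rewrite subst_instn; apply prf_allnE, IHprf.
  - apply prf_allsI; specialize (IHprf s0 (ups r0)).
    rewrite map_map in *; erewrite map_ext; [exact IHprf|].
    intro B; cbn; now rewrite subst_shifts.
  - rewrite subst_insts; apply prf_allsE, IHprf.
  - apply prf_refl.
  - rewrite subst_instn; eapply prf_leibniz; [apply IHprf1|].
    rewrite <- subst_instn; apply IHprf2.
Qed.

Lemma prf_weaken T G A : prf T G A -> forall G', incl G G' -> prf T G' A.
Proof.
  induction 1; intros G' HG.
  - apply prf_hyp; auto.
  - now apply prf_ax.
  - apply prf_impI, IHprf; intros C [->|HC]; [left|right]; auto.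
  - eapply prf_impE; eauto.
  - apply prf_raa, IHprf; intros C [->|HC]; [left|right]; auto.
  - apply prf_allnI, IHprf; intros C HC.
    apply in_map_iff in HC as [D [<- HD]]; apply in_map; auto.
  - apply prf_allnE; auto.
  - apply prf_allsI, IHprf; intros C HC.
    apply in_map_iff in HC as [D [<- HD]]; apply in_map; auto.
  - apply prf_allsE; auto.
  - apply prf_refl.
  - eapply prf_leibniz; eauto.
Qed.

Lemma prf_cut T G A B : prf T G A -> prf T (A :: G) B -> prf T G B.
Proof. intros HA HB; eapply prf_impE; [apply prf_impI, HB | exact HA]. Qed.

Lemma prf_bot T G A : prf T G fbot -> prf T G A.
Proof.
  intro H; apply prf_raa; eapply prf_weaken; eauto; intros C HC; now right.
Qed.

(* A variable not occurring in [G] and [A] is renamed to the eigenvariable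
   of the introduction rule. *)
Lemma prf_alln_fresh T G A n :
  subst_stable T -> (forall B, In B (alln A :: G) -> closed n n B) ->
  prf T G (instn A (tvar n)) -> prf T G (alln A).
Proof.
  intros HT Hn H; apply prf_allnI.
  set (s := fun k => if k =? n then tvar 0 else tvar (S k)).
  apply (prf_subst HT) with (s := s) (r := id_set) in H.
  assert (Hs : forall k, k < n -> s k = tvar (S k)).
  { intros k Hk; unfold s; destruct (Nat.eqb_spec k n); [lia|reflexivity]. }
  replace (map shiftn G) with (map (subst s id_set) G).
  2:{ apply map_ext_in; intros B HB; eapply subst_closed; eauto.
      apply Hn; now right. }
  replace A with (subst s id_set (instn A (tvar n))) at 1; [exact H|].
  unfold instn; rewrite subst_comp.
  transitivity (subst tvar (fun X => X) A); [|apply subst_id].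
  eapply subst_closed with (n := S n) (m := n).
  - apply (Hn (alln A)); now left.
  - intros [|k] Hk; cbn.
    + unfold s; now rewrite Nat.eqb_refl.
    + apply Hs; lia.
  - reflexivity.
Qed.

Lemma prf_alls_fresh T G A n :
  subst_stable T -> (forall B, In B (alls A :: G) -> closed n n B) ->
  prf T G (insts A n) -> prf T G (alls A).
Proof.
  intros HT Hn H; apply prf_allsI.
  set (r := fun k => if k =? n then 0 else S k).
  apply (prf_subst HT) with (s := tvar) (r := r) in H.
  assert (Hr : forall k, k < n -> r k = S k).
  { intros k Hk; unfold r; destruct (Nat.eqb_spec k n); [lia|reflexivity]. }
  replace (map shifts G) with (map (subst tvar r) G).
  2:{ apply map_ext_in; intros B HB; eapply subst_closed; eauto.
      apply Hn; now right. }
  replace A with (subst tvar r (insts A n)) at 1; [exact H|].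
  unfold insts; rewrite subst_comp.
  transitivity (subst tvar (fun X => X) A); [|apply subst_id].
  eapply subst_closed with (n := n) (m := S n).
  - apply (Hn (alls A)); now left.
  - reflexivity.
  - intros [|k] Hk; cbn.
    + unfold r; now rewrite Nat.eqb_refl.
    + apply Hr; lia.
Qed.

(** * Coding of formulas *)

Fixpoint tcode (t : term) : nat :=
  match t with
  | tvar n => to_nat (0, n)
  | tzero => to_nat (1, 0)
  | tone => to_nat (2, 0)
  | tadd a b => to_nat (3, to_nat (tcode a, tcode b))
  | tmul a b => to_nat (4, to_nat (tcode a, tcode b))
  end.

(** The codes serve twice: they enumerate the formulas in the Henkin construction, and they label
    the subformulas at the positions of f. *)
Fixpoint fcode (A : form) : nat :=
  match A with
  | feq s t => to_nat (0, to_nat (tcode s, tcode t))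
  | flt s t => to_nat (1, to_nat (tcode s, tcode t))
  | fmem t X => to_nat (2, to_nat (tcode t, X))
  | fbot => to_nat (3, 0)
  | fimp B C => to_nat (4, to_nat (fcode B, fcode C))
  | alln B => to_nat (5, fcode B)
  | alls B => to_nat (6, fcode B)
  end.

Lemma to_nat_inj p q : to_nat p = to_nat q -> p = q.
Proof.
  intro H; rewrite <- (cancel_of_to p), <- (cancel_of_to q); congruence.
Qed.

Lemma to_nat_inj2 a b c d : to_nat (a, b) = to_nat (c, d) -> a = c /\ b = d.
Proof. intro H; apply to_nat_inj in H; now injection H. Qed.

Ltac code_inj :=
  repeat match goal with
  | H : to_nat _ = to_nat _ |- _ =>
      apply to_nat_inj2 in H; destruct H; try discriminate
  end.

Lemma tcode_inj s : forall t, tcode s = tcode t -> s = t.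
Proof.
  induction s; intros [] H; unfold tcode in H; fold tcode in H;
    code_inj; f_equal; auto.
Qed.

Lemma fcode_inj A : forall B, fcode A = fcode B -> A = B.
Proof.
  induction A; intros [] H; unfold fcode in H; fold fcode in H;
    code_inj; f_equal; auto using tcode_inj.
Qed.

(** * Structures *)

(* The interpretation of [=] is Leibniz equality, and sets need not be
   extensional. *)
Record structure := Structure {
  dom : Type;
  vzero : dom;
  vone : dom;
  vadd : dom -> dom -> dom;
  vmul : dom -> dom -> dom;
  vlt : dom -> dom -> Prop;
  sets : Type;
  vmem : dom -> sets -> Prop
}.

Fixpoint teval (M : structure) (e : nat -> dom M) (t : term) : dom M :=
  match t with
  | tvar n => e n
  | tzero => vzero M
  | tone => vone M
  | tadd a b => vadd (teval e a) (teval e b)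
  | tmul a b => vmul (teval e a) (teval e b)
  end.

Fixpoint sat (M : structure) (e : nat -> dom M) (r : nat -> sets M)
    (A : form) : Prop :=
  match A with
  | feq s t => teval e s = teval e t
  | flt s t => vlt (teval e s) (teval e t)
  | fmem t X => vmem (teval e t) (r X)
  | fbot => False
  | fimp B C => sat e r B -> sat e r C
  | alln B => forall x, sat (scons x e) r B
  | alls B => forall X, sat e (scons X r) B
  end.

Definition models (M : structure) (T : form -> Prop) : Prop :=
  forall A e r, T A -> sat (M := M) e r A.

Section Satisfaction.

Variable M : structure.
Implicit Types (e : nat -> dom M) (r : nat -> sets M) (A B : form).

Lemma teval_subst e s t :
  teval e (tsubst s t) = teval (fun n => teval e (s n)) t.
Proof. induction t; cbn; congruence. Qed.

Lemma teval_tbound n e e' t :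
  tbound n t -> (forall k, k < n -> e k = e' k) -> teval e t = teval e' t.
Proof.
  induction t; cbn; intros H E; auto; destruct H; now rewrite IHt1, IHt2.
Qed.

Lemma sat_subst A : forall e r s (r' : nat -> nat),
  sat e r (subst s r' A)
  <-> sat (fun n => teval e (s n)) (fun X => r (r' X)) A.
Proof.
  induction A; intros e r s0 r'; cbn; rewrite ?teval_subst; try reflexivity.
  - now rewrite IHA1, IHA2.
  - split; intros H x; specialize (H x).
    + apply IHA in H; revert H.
      match goal with |- sat ?a _ _ -> sat ?b _ _ => replace a with b; auto end.
      apply functional_extensionality; intros [|n]; cbn; auto.
      now rewrite teval_subst.
    + apply IHA; revert H.
      match goal with |- sat ?a _ _ -> sat ?b _ _ => replace a with b; auto end.
      apply functional_extensionality; intros [|n]; cbn; auto.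
      now rewrite teval_subst.
  - split; intros H X; specialize (H X).
    + apply IHA in H; revert H.
      match goal with |- sat _ ?a _ -> sat _ ?b _ => replace a with b; auto end.
      now apply functional_extensionality; intros [|n].
    + apply IHA; revert H.
      match goal with |- sat _ ?a _ -> sat _ ?b _ => replace a with b; auto end.
      now apply functional_extensionality; intros [|n].
Qed.

Lemma sat_closed A : forall n m e e' r r',
  closed n m A -> (forall k, k < n -> e k = e' k) ->
  (forall X, X < m -> r X = r' X) -> sat e r A <-> sat e' r' A.
Proof.
  induction A; cbn; intros n0 m e e' r r' H E F.
  - destruct H; now rewrite (teval_tbound (t := s) (e := e) (e' := e') (n := n0)),
      (teval_tbound (t := t) (e := e) (e' := e') (n := n0)).
  - destruct H; now rewrite (teval_tbound (t := s) (e := e) (e' := e') (n := n0)),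
      (teval_tbound (t := t) (e := e) (e' := e') (n := n0)).
  - destruct H; now rewrite (teval_tbound (t := t) (e := e) (e' := e') (n := n0)), F.
  - reflexivity.
  - destruct H; now rewrite (IHA1 n0 m e e' r r'), (IHA2 n0 m e e' r r').
  - assert (forall x, sat (scons x e) r A <-> sat (scons x e') r' A) as K;
      [intro x | firstorder].
    apply IHA with (n := S n0) (m := m); auto.
    intros [|k] Hk; cbn; auto; apply E; lia.
  - assert (forall x, sat e (scons x r) A <-> sat e' (scons x r') A) as K;
      [intro x | firstorder].
    apply IHA with (n := n0) (m := S m); auto.
    intros [|k] Hk; cbn; auto; apply F; lia.
Qed.

Lemma sat_shifts e r X A : sat e (scons X r) (shifts A) <-> sat e r A.
Proof. unfold shifts; now rewrite sat_subst. Qed.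

Lemma sat_and e r A B : sat e r (fand A B) <-> sat e r A /\ sat e r B.
Proof. cbn; tauto. Qed.

Lemma sat_or e r A B : sat e r (for_ A B) <-> sat e r A \/ sat e r B.
Proof. cbn; tauto. Qed.

Lemma sat_iff e r A B : sat e r (fiff A B) <-> (sat e r A <-> sat e r B).
Proof. cbn; tauto. Qed.

Lemma sat_exn e r A : sat e r (exn A) <-> exists x, sat (scons x e) r A.
Proof.
  cbn; split; [|firstorder].
  intro H; apply NNPP; firstorder.
Qed.

Lemma sat_exs e r A : sat e r (exs A) <-> exists X, sat e (scons X r) A.
Proof.
  cbn; split; [|firstorder].
  intro H; apply NNPP; firstorder.
Qed.

(** This and the next lemmas each pass one connective or quantifier; [reflect_sat] chains them and
    so turns satisfaction of a concrete formula into what it expresses. *)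
Lemma reflect_and e r A B (P Q : Prop) : (sat e r A <-> P) -> (sat e r B <-> Q) ->
  sat e r (fand A B) <-> P /\ Q.
Proof. rewrite sat_and; tauto. Qed.

Lemma reflect_or e r A B (P Q : Prop) : (sat e r A <-> P) -> (sat e r B <-> Q) ->
  sat e r (for_ A B) <-> P \/ Q.
Proof. rewrite sat_or; tauto. Qed.

Lemma reflect_iff e r A B (P Q : Prop) : (sat e r A <-> P) -> (sat e r B <-> Q) ->
  sat e r (fiff A B) <-> (P <-> Q).
Proof. rewrite sat_iff; tauto. Qed.

Lemma reflect_imp e r A B (P Q : Prop) : (sat e r A <-> P) -> (sat e r B <-> Q) ->
  sat e r (fimp A B) <-> (P -> Q).
Proof. cbn; tauto. Qed.

Lemma reflect_neg e r A (P : Prop) : (sat e r A <-> P) ->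
  sat e r (fneg A) <-> ~ P.
Proof. cbn; tauto. Qed.

Lemma reflect_alln e r A (P : dom M -> Prop) :
  (forall x, sat (scons x e) r A <-> P x) -> sat e r (alln A) <-> forall x, P x.
Proof. cbn; firstorder. Qed.

Lemma reflect_alls e r A (P : sets M -> Prop) :
  (forall X, sat e (scons X r) A <-> P X) -> sat e r (alls A) <-> forall X, P X.
Proof. cbn; firstorder. Qed.

Lemma reflect_exn e r A (P : dom M -> Prop) :
  (forall x, sat (scons x e) r A <-> P x) -> sat e r (exn A) <-> exists x, P x.
Proof. rewrite sat_exn; firstorder. Qed.

End Satisfaction.

Ltac reflect_sat :=
  repeat lazymatch goal with
  | |- sat _ _ (fand _ _) <-> _ => apply reflect_and
  | |- sat _ _ (for_ _ _) <-> _ => apply reflect_or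
  | |- sat _ _ (fiff _ _) <-> _ => apply reflect_iff
  | |- sat _ _ (fimp _ _) <-> _ => apply reflect_imp
  | |- sat _ _ (fneg _) <-> _ => apply reflect_neg
  | |- sat _ _ (alln _) <-> _ => apply reflect_alln; intro
  | |- sat _ _ (alls _) <-> _ => apply reflect_alls; intro
  | |- sat _ _ (exn _) <-> _ => apply reflect_exn; intro
  end; try reflexivity.

(** The defined connectives stay folded, so that the reflection lemmas recognize them instead of the
    negated implications they abbreviate. *)
Ltac unfold_form :=
  lazymatch goal with |- sat ?e ?r ?A <-> ?P =>
    let A' := eval cbv -[fand for_ fneg fiff exn] in A in
    change (sat e r A' <-> P)
  end.

(** * Completeness *)

Section Henkin.

Variable T : form -> Prop.
Hypothesis HT : subst_stable T.

Definition consistent (G : list form) : Prop := ~ prf T G fbot.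

Definition fresh (G : list form) : nat :=
  epsilon (inhabits 0) (fun n => forall A, In A G -> closed n n A).

Lemma fresh_spec G A : In A G -> closed (fresh G) (fresh G) A.
Proof.
  revert A; apply (epsilon_spec (inhabits 0)
    (fun n => forall A, In A G -> closed n n A)), closed_ctx_ex.
Qed.

(* The witness for a negated universal formula is a fresh variable. *)
Definition henkin (G : list form) (A : form) : list form :=
  match A with
  | fimp (alln B) fbot => [fneg (instn B (tvar (fresh (alln B :: G))))]
  | fimp (alls B) fbot => [fneg (insts B (fresh (alls B :: G)))]
  | _ => []
  end.

Definition extend (G : list form) (A : form) : list form :=
  if excluded_middle_informative (consistent (A :: G))
  then henkin G A ++ A :: G else G.

(** The formula with code [n] is treated at stage n + 1. If [n] is not a code, [epsilon] yields an
    arbitrary formula; this is harmless, since any extension step preserves consistency. *)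
Fixpoint stage (A0 : form) (n : nat) : list form :=
  match n with
  | 0 => [A0]
  | S n => extend (stage A0 n)
             (epsilon (inhabits fbot) (fun A => fcode A = n))
  end.

(** If the negated instance at the fresh variable were contradictory, the instance would be
    derivable, hence by generalization the universal formula, against its negation [A] in the
    context. *)
Lemma consistent_extend G A : consistent G -> consistent (extend G A).
Proof.
  intro HG; unfold extend.
  destruct (excluded_middle_informative _) as [HA|]; [|exact HG].
  enough (K : forall B, In B (henkin G A) -> consistent (B :: A :: G)
            /\ henkin G A = [B]).
  { destruct (henkin G A) as [|B l] eqn:E; [exact HA|].
    destruct (K B) as [K1 K2]; [now left|].
    injection K2 as ->; exact K1. }
  assert (Hsub : forall C, In C G -> In C (A :: G)) by (intros; now right).
  destruct A as [| | | |A []| |]; cbn; try tauto; destruct A; cbn; try tauto;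
    intros B [<-|[]]; (split; [|reflexivity]); intro K; apply HA;
    apply prf_raa in K; (eapply prf_impE; [apply prf_hyp; now left|]).
  - eapply prf_alln_fresh; [exact HT | | exact K].
    intros C [<-|[<-|HC]]; [| split; [|exact I] |]; apply fresh_spec; cbn; auto.
  - eapply prf_alls_fresh; [exact HT | | exact K].
    intros C [<-|[<-|HC]]; [| split; [|exact I] |]; apply fresh_spec; cbn; auto.
Qed.

Lemma incl_extend G A : incl G (extend G A).
Proof.
  unfold extend; destruct (excluded_middle_informative _); intros B HB; auto.
  apply in_or_app; right; now right.
Qed.

Section Limit.

Variable A0 : form.
Hypothesis HA0 : consistent [A0].

Lemma consistent_stage n : consistent (stage A0 n).
Proof. induction n; [exact HA0|]; now apply consistent_extend. Qed.

Lemma stage_mono n m : n <= m -> incl (stage A0 n) (stage A0 m).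
Proof.
  induction 1; [apply incl_refl|].
  eapply incl_tran; [exact IHle | apply incl_extend].
Qed.

Definition limit (A : form) : Prop := exists n, prf T (stage A0 n) A.

Lemma limit_mp A B : limit (fimp A B) -> limit A -> limit B.
Proof.
  intros [n Hn] [m Hm]; exists (max n m); eapply prf_impE.
  - eapply prf_weaken; [exact Hn | apply stage_mono; lia].
  - eapply prf_weaken; [exact Hm | apply stage_mono; lia].
Qed.

Lemma limit_consistent : ~ limit fbot.
Proof. intros [n Hn]; now apply (consistent_stage (n := n)). Qed.

(** The second alternative also records that the witness of [A] was added with it; the quantifier
    cases depend on this. *)
Lemma limit_complete A :
  limit (fneg A)
  \/ limit A /\ exists n, incl (henkin (stage A0 n) A) (stage A0 (S n)).
Proof.
  set (n := fcode A).
  assert (E : stage A0 (S n) = extend (stage A0 n) A).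
  { cbn [stage]; f_equal; apply fcode_inj.
    apply (epsilon_spec (inhabits fbot) (fun B => fcode B = n)).
    now exists A. }
  unfold extend in E; destruct (excluded_middle_informative _) as [H|H].
  - right; split.
    + exists (S n); apply prf_hyp; rewrite E; apply in_or_app; right; now left.
    + exists n; rewrite E; apply incl_appl, incl_refl.
  - left; exists n; apply prf_impI, NNPP, H.
Qed.

Lemma limit_neg A : limit (fneg A) <-> ~ limit A.
Proof.
  split.
  - intros H1 H2; apply limit_consistent; exact (limit_mp H1 H2).
  - destruct (limit_complete A) as [|[]]; tauto.
Qed.

Lemma limit_taut A B : (forall G, prf T (A :: G) B) -> limit A -> limit B.
Proof.
  intros H [n Hn]; exists n; eapply prf_cut; [exact Hn | apply H].
Qed.

Lemma limit_imp A B : limit (fimp A B) <-> (limit A -> limit B).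
Proof.
  split; [apply limit_mp|].
  intro H; destruct (classic (limit A)) as [HA|HA].
  - generalize (H HA); apply limit_taut; intro G.
    apply prf_impI, prf_hyp; cbn; auto.
  - apply limit_neg in HA; revert HA; apply limit_taut; intro G.
    apply prf_impI, prf_bot; apply prf_impE with A; apply prf_hyp; cbn; auto.
Qed.

(** If the universal formula is not in the limit theory, its negation was accepted at its stage, and
    the fresh variable added there gives an instance that fails. *)
Lemma limit_alln A : limit (alln A) <-> forall t, limit (instn A t).
Proof.
  split.
  - intros [n Hn] t; exists n; now apply prf_allnE.
  - intro H; apply NNPP; intro K; apply limit_neg in K.
    destruct (limit_complete (fneg (alln A))) as [K'|[_ [n Hn]]].
    + apply limit_neg in K'; tauto.
    + assert (L : limit (fneg (instn A (tvar (fresh (alln A :: stage A0 n)))))).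
      { exists (S n); apply prf_hyp, Hn; now left. }
      apply limit_neg in L; apply L, H.
Qed.

Lemma limit_alls A : limit (alls A) <-> forall X, limit (insts A X).
Proof.
  split.
  - intros [n Hn] t; exists n; now apply prf_allsE.
  - intro H; apply NNPP; intro K; apply limit_neg in K.
    destruct (limit_complete (fneg (alls A))) as [K'|[_ [n Hn]]].
    + apply limit_neg in K'; tauto.
    + assert (L : limit (fneg (insts A (fresh (alls A :: stage A0 n))))).
      { exists (S n); apply prf_hyp, Hn; now left. }
      apply limit_neg in L; apply L, H.
Qed.

Lemma limit_ax A : T A -> limit A.
Proof. intro H; exists 0; now apply prf_ax. Qed.

Lemma limit_refl t : limit (feq t t).
Proof. exists 0; apply prf_refl. Qed.

Lemma limit_leibniz A s t :
  limit (feq s t) -> limit (instn A s) -> limit (instn A t).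
Proof.
  intros [n Hn] [m Hm]; exists (max n m); eapply prf_leibniz.
  - eapply prf_weaken; [exact Hn | apply stage_mono; lia].
  - eapply prf_weaken; [exact Hm | apply stage_mono; lia].
Qed.

(** Here [B] is the context of the Leibniz rule with variable 0 as its hole; the other terms of the
    context are shifted past the hole by [tshift]. *)
Lemma limit_congr (A : term -> form) s t (B : form) :
  (forall u, instn B u = A u) ->
  limit (feq s t) -> limit (A s) -> limit (A t).
Proof. intros E Hst; rewrite <- !E; now apply limit_leibniz. Qed.

Definition tshift (t : term) : term := tsubst (fun n => tvar (S n)) t.

Lemma tsubst_tshift u t : tsubst (scons u tvar) (tshift t) = t.
Proof. unfold tshift; rewrite tsubst_comp; apply tsubst_id. Qed.

Lemma limit_sym s t : limit (feq s t) -> limit (feq t s).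
Proof.
  intro H; apply (limit_congr (A := fun u => feq u s) (s := s)
    (B := feq (tvar 0) (tshift s))); [|exact H|apply limit_refl].
  intro u; cbn; now rewrite tsubst_tshift.
Qed.

Lemma limit_trans s t u :
  limit (feq s t) -> limit (feq t u) -> limit (feq s u).
Proof.
  intros H H'; apply (limit_congr (A := fun u => feq s u) (s := t)
    (B := feq (tshift s) (tvar 0))); [|exact H'|exact H].
  intro v; cbn; now rewrite tsubst_tshift.
Qed.

Lemma limit_add s s' t t' : limit (feq s s') -> limit (feq t t') ->
  limit (feq (tadd s t) (tadd s' t')).
Proof.
  intros H H'; apply limit_trans with (tadd s' t).
  - apply (limit_congr (A := fun u => feq (tadd s t) (tadd u t)) (s := s)
      (B := feq (tshift (tadd s t)) (tadd (tvar 0) (tshift t))));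
      [|exact H|apply limit_refl].
    intro u; cbn; now rewrite !tsubst_tshift.
  - apply (limit_congr (A := fun u => feq (tadd s' t) (tadd s' u)) (s := t)
      (B := feq (tshift (tadd s' t)) (tadd (tshift s') (tvar 0))));
      [|exact H'|apply limit_refl].
    intro u; cbn; now rewrite !tsubst_tshift.
Qed.

Lemma limit_mul s s' t t' : limit (feq s s') -> limit (feq t t') ->
  limit (feq (tmul s t) (tmul s' t')).
Proof.
  intros H H'; apply limit_trans with (tmul s' t).
  - apply (limit_congr (A := fun u => feq (tmul s t) (tmul u t)) (s := s)
      (B := feq (tshift (tmul s t)) (tmul (tvar 0) (tshift t))));
      [|exact H|apply limit_refl].
    intro u; cbn; now rewrite !tsubst_tshift.
  - apply (limit_congr (A := fun u => feq (tmul s' t) (tmul s' u)) (s := t)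
      (B := feq (tshift (tmul s' t)) (tmul (tshift s') (tvar 0))));
      [|exact H'|apply limit_refl].
    intro u; cbn; now rewrite !tsubst_tshift.
Qed.

Lemma limit_lt s s' t t' : limit (feq s s') -> limit (feq t t') ->
  limit (flt s t) -> limit (flt s' t').
Proof.
  intros H H' L.
  apply (limit_congr (A := fun u => flt s' u) (s := t)
    (B := flt (tshift s') (tvar 0))); [|exact H'|].
  { intro u; cbn; now rewrite !tsubst_tshift. }
  apply (limit_congr (A := fun u => flt u t) (s := s)
    (B := flt (tvar 0) (tshift t))); [|exact H|exact L].
  intro u; cbn; now rewrite !tsubst_tshift.
Qed.

Lemma limit_mem s t X :
  limit (feq s t) -> limit (fmem s X) -> limit (fmem t X).
Proof.
  apply (limit_congr (A := fun u => fmem u X) (B := fmem (tvar 0) X)).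
  reflexivity.
Qed.

(* The domain is the set of chosen representatives of the classes of terms
   that the limit theory identifies. *)
Definition rep (t : term) : term :=
  epsilon (inhabits tzero) (fun s => limit (feq t s)).

Lemma rep_spec t : limit (feq t (rep t)).
Proof.
  apply (epsilon_spec (inhabits tzero) (fun s => limit (feq t s))).
  exists t; apply limit_refl.
Qed.

Lemma rep_eq s t : rep s = rep t <-> limit (feq s t).
Proof.
  split; intro H.
  - apply limit_trans with (rep s); [apply rep_spec|].
    rewrite H; apply limit_sym, rep_spec.
  - unfold rep; f_equal; apply functional_extensionality; intro u.
    apply propositional_extensionality; split; intro K.
    + eapply limit_trans; [apply limit_sym, H | exact K].
    + eapply limit_trans; [exact H | exact K].
Qed.

Lemma rep_idem t : rep (rep t) = rep t.
Proof. apply rep_eq, limit_sym, rep_spec. Qed.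

Definition hdom : Type := {t : term | rep t = t}.
Definition cls (t : term) : hdom := exist _ (rep t) (rep_idem t).

Lemma cls_eq s t : cls s = cls t <-> limit (feq s t).
Proof.
  rewrite <- rep_eq; split; intro H.
  - now injection H.
  - apply eq_sig_hprop; [intros; apply proof_irrelevance | exact H].
Qed.

Lemma cls_proj (x : hdom) : cls (proj1_sig x) = x.
Proof.
  destruct x as [t Ht].
  apply eq_sig_hprop; [intros; apply proof_irrelevance | exact Ht].
Qed.

Lemma limit_proj_cls t : limit (feq (proj1_sig (cls t)) t).
Proof. apply limit_sym, rep_spec. Qed.

Definition hmodel : structure := {|
  dom := hdom;
  vzero := cls tzero;
  vone := cls tone;
  vadd x y := cls (tadd (proj1_sig x) (proj1_sig y));
  vmul x y := cls (tmul (proj1_sig x) (proj1_sig y));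
  vlt x y := limit (flt (proj1_sig x) (proj1_sig y));
  sets := nat;
  vmem x X := limit (fmem (proj1_sig x) X) |}.

Lemma hmodel_teval s t :
  teval (M := hmodel) (fun n => cls (s n)) t = cls (tsubst s t).
Proof.
  induction t; cbn; try reflexivity; rewrite IHt1, IHt2; apply cls_eq;
    (apply limit_add || apply limit_mul); apply limit_proj_cls.
Qed.

Lemma hmodel_sat A : forall s r,
  sat (M := hmodel) (fun n => cls (s n)) r A <-> limit (subst s r A).
Proof.
  induction A; intros s0 r; cbn; rewrite ?hmodel_teval.
  - apply cls_eq.
  - split; apply limit_lt; (apply limit_proj_cls || apply limit_sym, limit_proj_cls).
  - split; apply limit_mem; (apply limit_proj_cls || apply limit_sym, limit_proj_cls).
  - split; [tauto | apply limit_consistent].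
  - now rewrite limit_imp, IHA1, IHA2.
  - rewrite limit_alln.
    assert (K : forall t, sat (M := hmodel) (scons (cls t) (fun n => cls (s0 n))) r A
                  <-> limit (instn (subst (upn s0) r A) t)).
    { intro t; rewrite instn_subst, <- IHA.
      replace (fun n => cls (scons t s0 n)) with (scons (cls t) (fun n => cls (s0 n)));
        [reflexivity|].
      now apply functional_extensionality; intros [|n]. }
    split.
    + intros H t; apply K, H.
    + intros H x; rewrite <- (cls_proj x); apply K, H.
  - rewrite limit_alls; split; intros H X; specialize (H X);
      rewrite insts_subst, <- IHA in *; exact H.
Qed.

(** An assignment amounts to substituting representative terms for the free variables, and [HT]
    makes the substituted axiom an axiom again. *)
Lemma hmodel_models : models hmodel T.
Proof.
  intros A e r HA.
  replace e with (fun n => cls (proj1_sig (e n))).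
  - apply (hmodel_sat A (fun n => proj1_sig (e n))), limit_ax, HT, HA.
  - apply functional_extensionality; intro; apply cls_proj.
Qed.

End Limit.

(** The sets of the Henkin model are the set variables, so the hypothesis may be restricted to
    structures with at least one set; such a set later fills irrelevant set variables. *)
Theorem completeness A :
  (forall M, inhabited (sets M) -> models M T ->
     forall e r, sat (M := M) e r A) ->
  provable T A.
Proof.
  intro H; apply NNPP; intro K.
  assert (HA : consistent [fneg A]) by (intro L; apply K, prf_raa, L).
  specialize (H (hmodel (fneg A)) (inhabits 0) (hmodel_models HA)
    (fun n => cls (fneg A) (tvar n)) (fun X => X)).
  apply (hmodel_sat HA) in H; rewrite subst_id in H.
  apply (limit_neg HA) in H; [exact H|].
  exists 0; apply prf_hyp; now left.
Qed.

End Henkin.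

(** * Substitution in the axioms, and closedness of the defining formula *)

Lemma ACA0_subst_stable : subst_stable ACA0.
Proof.
  intros A s r []; try (constructor; fail).
  (* Only comprehension has free variables. Substitution commutes with the shift that protects the
     new set, so the result is comprehension for the substituted formula. *)
  cbn; rewrite subst_shifts.
  now apply aca_comprehension, arithmetical_subst.
Qed.

Import SpaceFormula.
Lemma arithmetical_space_form rho : arithmetical rho -> arithmetical (space_form rho).
Proof. intro H; cbv -[arithmetical]; cbn; repeat split; exact H. Qed.

Lemma closed_space_form rho : closed 6 1 rho -> closed 1 1 (space_form rho).
Proof.
  intro H.
  assert (K : forall n, 6 <= n -> closed n 1 rho).
  { intros n Hn; apply (closed_mono Hn (le_n 1) H). }
  cbv -[closed]; cbn; repeat split; try apply K; lia.
Qed.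

(** * Skolemized truth *)

(* A function f describes the truth of the subformulas [A], each with [d] free
   number variables: at the index of [A] and of an assignment, f is 0 if [A] is
   true, and otherwise nonzero; if [A] is [alln B], it is then y + 1 with [B]
   false of y.  The set [X] with index 0 in [A] is given by the values of f at
   the atomic formula [set_atom]. *)

Fixpoint num (n : nat) : term :=
  match n with 0 => tzero | S n => tadd (num n) tone end.

Definition pair_term (s t : term) : term := tadd (tmul (tadd s t) (tadd s t)) s.

Fixpoint tuple_term (d b : nat) : term :=
  match d with
  | 0 => tzero
  | S d => pair_term (tvar b) (tuple_term d (S b))
  end.

(** The depth belongs to the tag because one formula may occur under different numbers of
    quantifiers, with assignments of different lengths. *)
Definition tag (d : nat) (A : form) : nat := to_nat (d, fcode A).

Definition index_term (d : nat) (A : form) : term :=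
  pair_term (num (tag d A)) (tuple_term d 0).

Definition set_atom : form := fmem (tvar 0) 0.

Fixpoint allns (d : nat) (A : form) : form :=
  match d with 0 => A | S d => alln (allns d A) end.

Definition is_zero (n : nat) : form := feq (tvar n) tzero.

(* Below [d] quantifiers, the variables d, ..., d + 5 are the positions and
   the values i1, y1, i2, y2, i3, y3 of three entries of f. *)
Definition clause (d : nat) (A : form) : form :=
  match A with
  | fmem t 0 =>
      fimp (feq (tvar (d + 2)) (pair_term (num (tag 1 set_atom)) (pair_term t tzero)))
        (fiff (is_zero (d + 1)) (is_zero (d + 3)))
  | fmem t (S Y) => fiff (is_zero (d + 1)) (fmem t Y)
  | fimp B C =>
      fimp (feq (tvar (d + 2)) (index_term d B))
        (fimp (feq (tvar (d + 4)) (index_term d C))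
          (fiff (is_zero (d + 1)) (fimp (is_zero (d + 3)) (is_zero (d + 5)))))
  | alln B =>
      alln (fimp (feq (tvar (S d + 2)) (index_term (S d) B))
        (fand (fimp (is_zero (S d + 1)) (is_zero (S d + 3)))
          (fimp (feq (tvar (S d + 1)) (tadd (tvar 0) tone))
            (fneg (is_zero (S d + 3))))))
  | _ => fiff (is_zero (d + 1)) A
  end.

Definition constraint (d : nat) (A : form) : form :=
  allns d (fimp (feq (tvar (d + 0)) (index_term d A)) (clause d A)).

Fixpoint subs (d : nat) (A : form) : list (nat * form) :=
  (d, A) ::
  match A with
  | fimp B C => subs d B ++ subs d C
  | alln B => subs (S d) B
  | _ => []
  end.

(** The pair [(1, set_atom)] is added by hand: every membership clause for X refers to it, whether
    or not it occurs in [A] in this form. *)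
Definition occurrences (A : form) : list (nat * form) :=
  (1, set_atom) :: subs 0 A.

Definition falsity_constraint (A : form) : form :=
  fimp (feq (tvar 0) (index_term 0 A)) (fneg (is_zero 1)).

(** Truth is described for the subformulas of one fixed [A], so a finite conjunction, and hence a
    single arithmetical formula, does it. *)
Definition skolem (A : form) : form :=
  fold_right (fun p F => fand (constraint (fst p) (snd p)) F)
    (falsity_constraint A) (occurrences A).

Lemma subs_self d A : In (d, A) (subs d A).
Proof. destruct A; now left. Qed.

Lemma subs_incl A : forall d d' B,
  In (d', B) (subs d A) -> incl (subs d' B) (subs d A).
Proof.
  induction A; intros d d' B [E|H]; try (injection E as <- <-; apply incl_refl);
    try destruct H; cbn in H.
  - apply incl_tl; apply in_app_or in H as [H|H];
      [apply incl_appl | apply incl_appr]; auto.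
  - apply incl_tl; auto.
Qed.

Lemma subs_closed A : forall d d' m B,
  closed d m A -> In (d', B) (subs d A) -> closed d' m B.
Proof.
  induction A; intros d d' m B HA [E|H]; try (injection E as <- <-; exact HA);
    try destruct H; cbn in H, HA.
  - apply in_app_or in H as [H|H]; [eapply IHA1 | eapply IHA2]; eauto; apply HA.
  - eauto.
Qed.

Lemma subs_arithmetical A : forall d d' B,
  arithmetical A -> In (d', B) (subs d A) -> arithmetical B.
Proof.
  induction A; intros d d' B HA [E|H]; try (injection E as <- <-; exact HA);
    try destruct H; cbn in H, HA.
  - apply in_app_or in H as [H|H]; [eapply IHA1 | eapply IHA2]; eauto; apply HA.
  - eauto.
Qed.

Lemma occurrences_closed A d B :
  closed 0 2 A -> In (d, B) (occurrences A) -> closed d 2 B.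
Proof.
  intros HA [E|H]; [injection E as <- <-; cbn; lia|].
  eapply subs_closed; eauto.
Qed.

Lemma occurrences_arithmetical A d B :
  arithmetical A -> In (d, B) (occurrences A) -> arithmetical B.
Proof.
  intros HA [E|H]; [injection E as <- <-; exact I|].
  eapply subs_arithmetical; eauto.
Qed.

Lemma occurrences_sub A d B :
  In (d, B) (occurrences A) -> incl (subs d B) (occurrences A).
Proof.
  intros [E|H].
  - injection E as <- <-; intros p [<-|[]]; now left.
  - apply incl_tl, subs_incl, H.
Qed.

Lemma tbound_num n k : tbound n (num k).
Proof. induction k; cbn; auto. Qed.

Lemma tbound_tuple n d : forall b, b + d <= n -> tbound n (tuple_term d b).
Proof.
  induction d; cbn; intros b H; [exact I|].
  repeat split; try lia; apply IHd; lia.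
Qed.

Lemma tbound_index n d A : d <= n -> tbound n (index_term d A).
Proof.
  intro H; cbn; repeat split; auto using tbound_num, tbound_tuple.
Qed.

Lemma closed_allns d m A : forall n, closed (d + n) m A -> closed n m (allns d A).
Proof.
  induction d; cbn; intros n H; [exact H|].
  apply IHd; now rewrite Nat.add_succ_r.
Qed.

Lemma arithmetical_allns d A : arithmetical A -> arithmetical (allns d A).
Proof. induction d; auto. Qed.

Lemma closed_constraint d A :
  arithmetical A -> closed d 2 A -> closed 6 1 (constraint d A).
Proof.
  intros HA H; apply closed_allns; split.
  - split; [cbn; lia | apply tbound_index; lia].
  - assert (K := tbound_mono (n := d) (n' := d + 6)).
    destruct A; cbn in HA, H |- *; try tauto.
    + repeat split; try lia; apply K; tauto || lia.
    + repeat split; try lia; apply K; tauto || lia.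
    + destruct X; cbn; repeat split; try lia; try apply tbound_num;
        apply K; tauto || lia.
    + repeat split; lia.
    + repeat split; try lia; try apply tbound_num; apply tbound_tuple; lia.
    + repeat split; try lia; try apply tbound_num; apply tbound_tuple; lia.
Qed.

Lemma arithmetical_constraint d A :
  arithmetical A -> arithmetical (constraint d A).
Proof.
  intro HA; apply arithmetical_allns; split; [exact I|].
  destruct A; cbn in *; try tauto; destruct X; cbn; tauto.
Qed.

(** The set variable for X has disappeared, because membership in it is replaced by values of f;
    what remains is Z and the six numbers of three entries. *)
Lemma closed_skolem A : arithmetical A -> closed 0 2 A -> closed 6 1 (skolem A).
Proof.
  intros HA H; unfold skolem.
  assert (K : forall p, In p (occurrences A) ->
            closed 6 1 (constraint (fst p) (snd p))).
  { intros [d B] Hp; apply closed_constraint.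
    - eapply occurrences_arithmetical; eauto.
    - eapply occurrences_closed; eauto. }
  induction (occurrences A) as [|p l IH].
  - split; [split; [cbn; lia | apply tbound_index; lia]|].
    cbn; repeat split; lia.
  - cbn [fold_right]; split; [|exact I]; split; [apply K; now left|].
    split; [|exact I]; apply IH; intros q Hq; apply K; now right.
Qed.

Lemma arithmetical_skolem A : arithmetical A -> arithmetical (skolem A).
Proof.
  intros HA; unfold skolem.
  assert (K : forall p, In p (occurrences A) ->
            arithmetical (constraint (fst p) (snd p))).
  { intros [d B] Hp; eapply arithmetical_constraint, occurrences_arithmetical; eauto. }
  induction (occurrences A) as [|p l IH]; [cbn; auto|].
  cbn [fold_right]; split; [|exact I]; split; [apply K; now left|].
  split; [|exact I]; apply IH; intros q Hq; apply K; now right.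
Qed.

(** * Arithmetic in a model *)

Declare Scope dom_scope.
Delimit Scope dom_scope with dom.
Notation "0" := (vzero _) : dom_scope.
Notation "1" := (vone _) : dom_scope.
Notation "x + y" := (vadd x y) : dom_scope.
Notation "x * y" := (vmul x y) : dom_scope.
Notation "x < y" := (vlt x y) : dom_scope.
Notation "x <= y" := (vlt x y \/ x = y) : dom_scope.

(** * Relations arithmetically definable with parameters *)

Section Definability.

Variable M : structure.
Implicit Types (e : nat -> dom M) (P Q : (nat -> dom M) -> Prop).

(* Variables of the formula stand for arguments ([inl]) or for fixed
   parameters ([inr]). *)
Definition assign (v : nat -> nat + dom M) e : nat -> dom M :=
  fun k => match v k with inl i => e i | inr x => x end.

Definition defterm (f : (nat -> dom M) -> dom M) : Prop :=
  exists t v, forall e, teval (assign v e) t = f e.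

(** Comprehension and induction are limited to arithmetical formulas. This predicate lets Rocq
    propositions be used in them without writing the formulas; number and set parameters are
    arbitrary. *)
Definition definable P : Prop :=
  exists A v r, arithmetical A /\ forall e, sat (assign v e) r A <-> P e.

Lemma defterm_var i : defterm (fun e => e i).
Proof. now exists (tvar 0), (fun _ => inl i). Qed.

Lemma defterm_const x : defterm (fun _ => x).
Proof. now exists (tvar 0), (fun _ => inr x). Qed.

(** Two formulas with unrelated parameters are joined by moving the variables of one to the even and
    those of the other to the odd indices. *)
Definition interleave (T : Type) (f g : nat -> T) : nat -> T :=
  fun k => if Nat.even k then f (Nat.div2 k) else g (Nat.div2 k).

Lemma interleave_even T (f g : nat -> T) k : interleave f g (2 * k) = f k.
Proof.
  unfold interleave; now rewrite Nat.even_even, Nat.div2_double.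
Qed.

Lemma interleave_odd T (f g : nat -> T) k : interleave f g (S (2 * k)) = g k.
Proof.
  unfold interleave; rewrite Nat.even_succ, <- Nat.negb_even, Nat.even_even.
  now rewrite Nat.div2_succ_double.
Qed.

Lemma assign_even v w e :
  (fun k => assign (interleave v w) e (2 * k)) = assign v e.
Proof.
  apply functional_extensionality; intro k; unfold assign.
  now rewrite interleave_even.
Qed.

Lemma assign_odd v w e :
  (fun k => assign (interleave v w) e (S (2 * k))) = assign w e.
Proof.
  apply functional_extensionality; intro k; unfold assign.
  now rewrite interleave_odd.
Qed.

Definition evar := fun k => tvar (2 * k).
Definition ovar := fun k => tvar (S (2 * k)).

Lemma teval_even v w e t :
  teval (assign (interleave v w) e) (tsubst evar t) = teval (assign v e) t.
Proof. rewrite teval_subst, <- (assign_even v w); reflexivity. Qed.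

Lemma teval_odd v w e t :
  teval (assign (interleave v w) e) (tsubst ovar t) = teval (assign w e) t.
Proof. rewrite teval_subst, <- (assign_odd v w); reflexivity. Qed.

Lemma defterm_add f g :
  defterm f -> defterm g -> defterm (fun e => (f e + g e)%dom).
Proof.
  intros [s [v Hs]] [t [w Ht]].
  exists (tadd (tsubst evar s) (tsubst ovar t)), (interleave v w).
  intro e; cbn; now rewrite teval_even, teval_odd, Hs, Ht.
Qed.

Lemma defterm_mul f g :
  defterm f -> defterm g -> defterm (fun e => (f e * g e)%dom).
Proof.
  intros [s [v Hs]] [t [w Ht]].
  exists (tmul (tsubst evar s) (tsubst ovar t)), (interleave v w).
  intro e; cbn; now rewrite teval_even, teval_odd, Hs, Ht.
Qed.

Lemma definable_eq (S : inhabited (sets M)) f g :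
  defterm f -> defterm g -> definable (fun e => f e = g e).
Proof.
  destruct S as [X].
  intros [s [v Hs]] [t [w Ht]].
  exists (feq (tsubst evar s) (tsubst ovar t)), (interleave v w), (fun _ => X).
  split; [exact I|].
  intro e; cbn; now rewrite teval_even, teval_odd, Hs, Ht.
Qed.

Lemma definable_lt (S : inhabited (sets M)) f g :
  defterm f -> defterm g -> definable (fun e => (f e < g e)%dom).
Proof.
  destruct S as [X].
  intros [s [v Hs]] [t [w Ht]].
  exists (flt (tsubst evar s) (tsubst ovar t)), (interleave v w), (fun _ => X).
  split; [exact I|].
  intro e; cbn; now rewrite teval_even, teval_odd, Hs, Ht.
Qed.

Lemma definable_mem X f :
  defterm f -> definable (fun e => vmem (f e) X).
Proof.
  intros [t [v Ht]]; exists (fmem t 0), v, (fun _ => X); split; [exact I|].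
  intro e; cbn; now rewrite Ht.
Qed.

Lemma definable_imp P Q :
  definable P -> definable Q -> definable (fun e => P e -> Q e).
Proof.
  intros [A [v [r [HA HP]]]] [B [w [r' [HB HQ]]]].
  exists (fimp (subst evar (fun X => 2 * X) A)
          (subst ovar (fun X => S (2 * X)) B)),
    (interleave v w), (interleave r r').
  split; [cbn; auto using arithmetical_subst|].
  intro e; rewrite <- HP, <- HQ; cbn [sat]; rewrite !sat_subst.
  unfold evar, ovar; cbn [teval].
  replace (fun X => interleave r r' (2 * X)) with r
    by (apply functional_extensionality; intro; now rewrite interleave_even).
  replace (fun X => interleave r r' (S (2 * X))) with r'
    by (apply functional_extensionality; intro; now rewrite interleave_odd).
  now rewrite assign_even, assign_odd.
Qed.

Lemma definable_all (P : dom M -> (nat -> dom M) -> Prop) :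
  definable (fun e => P (e 0) (fun k => e (S k))) ->
  definable (fun e => forall x, P x e).
Proof.
  intros [A [v [r [HA HP]]]].
  exists (alln (subst (fun k => match v k with inl 0 => tvar 0
                                 | _ => tvar (S k) end) (fun X => X) A)),
    (* The value at [inl 0] is a dummy: those variables have all been redirected to the new
       quantifier. *)
    (fun k => match v k with inl (S i) => inl i | inl 0 => inl 0
              | inr x => inr x end), r.
  split; [now apply arithmetical_subst|].
  intro e; cbn [sat].
  assert (E : forall x, sat (assign v (scons x e)) r A <-> P x e).
  { intro x; now rewrite HP. }
  split; intros H x; [apply E | apply E in H || specialize (H x); apply E in H].
  - specialize (H x); rewrite sat_subst in H; revert H.
    match goal with |- sat ?a _ _ -> sat ?b _ _ => replace a with b; auto end.
    apply functional_extensionality; intro k; unfold assign.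
    destruct (v k) as [[|i]|y] eqn:F; cbn; rewrite ?F; reflexivity.
  - rewrite sat_subst; revert H.
    match goal with |- sat ?a _ _ -> sat ?b _ _ => replace b with a; auto end.
    apply functional_extensionality; intro k; unfold assign.
    destruct (v k) as [[|i]|y] eqn:F; cbn; rewrite ?F; reflexivity.
Qed.

Lemma definable_iff P Q :
  definable P -> (forall e, P e <-> Q e) -> definable Q.
Proof.
  intros [A [v [r [HA HP]]]] H; exists A, v, r; split; [exact HA|].
  intro e; now rewrite HP.
Qed.

Lemma definable_false (S : inhabited (sets M)) : definable (fun _ => False).
Proof.
  destruct S as [X].
  now exists fbot, inl, (fun _ => X).
Qed.

Lemma definable_not P : definable P -> definable (fun e => ~ P e).
Proof.
  intros HP; apply definable_imp; [exact HP|].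
  destruct HP as [A [v [r H]]]; exact (definable_false (inhabits (r 0))).
Qed.

Lemma definable_and P Q :
  definable P -> definable Q -> definable (fun e => P e /\ Q e).
Proof.
  intros HP HQ; apply definable_iff with (fun e => ~ (P e -> ~ Q e)).
  - auto using definable_imp, definable_not.
  - intro e; tauto.
Qed.

Lemma definable_or P Q :
  definable P -> definable Q -> definable (fun e => P e \/ Q e).
Proof.
  intros HP HQ; apply definable_iff with (fun e => ~ P e -> Q e).
  - auto using definable_imp, definable_not.
  - intro e; tauto.
Qed.

Lemma definable_equiv P Q :
  definable P -> definable Q -> definable (fun e => P e <-> Q e).
Proof.
  intros; apply definable_and; now apply definable_imp.
Qed.

Lemma definable_ex (P : dom M -> (nat -> dom M) -> Prop) :
  definable (fun e => P (e 0) (fun k => e (S k))) ->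
  definable (fun e => exists x, P x e).
Proof.
  intro H; apply definable_iff with (fun e => ~ forall x, ~ P x e).
  - apply definable_not, definable_all, definable_not, H.
  - intro e; split; [|firstorder].
    intro K; apply NNPP; firstorder.
Qed.

Lemma definable_rename P ren :
  definable P -> definable (fun e => P (fun k => e (ren k))).
Proof.
  intros [A [v [r [HA HP]]]].
  exists A, (fun k => match v k with inl i => inl (ren i) | inr x => inr x end), r.
  split; [exact HA|]; intro e; rewrite <- HP.
  replace (assign v (fun k => e (ren k))) with
    (assign (fun k => match v k with inl i => inl (ren i) | inr x => inr x end) e);
    [reflexivity|].
  apply functional_extensionality; intro k; unfold assign; now destruct (v k).
Qed.

(** Naming the two values by existential quantifiers allows a relation known to be definable in
    variables to be applied to terms. *)
Lemma definable_rel2 (S : inhabited (sets M)) (R : dom M -> dom M -> Prop) f g :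
  definable (fun e => R (e 0) (e 1)) -> defterm f -> defterm g ->
  definable (fun e => R (f e) (g e)).
Proof.
  intros HR Hf Hg.
  assert (K : forall f, defterm f -> forall n, defterm (fun e => f (fun k => e (n + k)))).
  { intros h [t [v H]] n.
    exists t, (fun k => match v k with inl i => inl (n + i) | inr x => inr x end).
    intro e; rewrite <- H; f_equal; apply functional_extensionality; intro k.
    unfold assign; now destruct (v k). }
  apply definable_iff with
    (fun e => exists x, x = f e /\ exists y, y = g e /\ R x y).
  - apply definable_ex, definable_and.
    + apply definable_eq; [exact S | apply defterm_var | now apply (K f Hf 1)].
    + apply definable_ex, definable_and.
      * apply definable_eq; [exact S | apply defterm_var | now apply (K g Hg 2)].
      (* Below the two quantifiers y is variable 0 and x is variable 1, hence the swap. *)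
      * apply (definable_rename (P := fun e => R (e 0) (e 1))
                 (fun k => match k with 0 => 1 | _ => 0 end)), HR.
  - intro e; split; [now intros [x [-> [y [-> H]]]]|].
    intro H; exists (f e); split; [reflexivity|]; now exists (g e).
Qed.

End Definability.

Ltac definability :=
  cbv beta;
  repeat first [assumption | lazymatch goal with
  | |- definable (fun e => forall x : dom _, _) => apply definable_all; cbv beta
  | |- definable (fun e => exists x, _) => apply definable_ex; cbv beta
  | |- definable (fun e => _ /\ _) => apply definable_and
  | |- definable (fun e => _ \/ _) => apply definable_or
  | |- definable (fun e => _ <-> _) => apply definable_equiv
  | |- definable (fun e => ~ _) => apply definable_not
  | |- definable (fun e => _ -> _) => apply definable_imp
  | |- definable (fun e => _ = _) => apply definable_eq; [assumption| |]
  | |- definable (fun e => vlt _ _) => apply definable_lt; [assumption| |]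
  | |- definable (fun e => vmem _ _) => apply definable_mem
  | |- definable (fun e => False) => apply definable_false; assumption
  | |- definable (fun e => ?R (@?f e) (@?g e)) =>
      refine (@definable_rel2 _ _ R f g _ _ _); [assumption|assumption| |]
  | |- defterm (fun e => vadd _ _) => apply defterm_add
  | |- defterm (fun e => vmul _ _) => apply defterm_mul
  | |- defterm (fun e => e _) => apply defterm_var
  | |- defterm (fun e => _) => apply defterm_const
  end].

(** * Induction, semiring laws and order from the axioms *)

Section Arithmetic.

Variable M : structure.
Hypothesis HS : inhabited (sets M).
Hypothesis HM : models M ACA0.
Implicit Types (a b c i j k l m n p q r s t u v w x y z : dom M).
Open Scope dom_scope.

Lemma comprehension (P : dom M -> Prop) :
  definable (fun e => P (e O)) -> exists X, forall n, vmem n X <-> P n.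
Proof.
  intros [A [v [r [HA HP]]]].
  set (A' := subst (fun k : nat => match v k with inl O => tvar O
                              | _ => tvar (S k) end) (fun X => X) A).
  assert (H : ACA0 (exs (alln (fiff (fmem (tvar O) O) (shifts A'))))).
  { now apply aca_comprehension, arithmetical_subst. }
  (* Parameters remain free variables of the axiom and get their values here; arguments other than
     the first cannot influence [P] and are set to 0. *)
  apply (@HM _ (fun k : nat => match v k with inr x => x | _ => 0 end) r) in H.
  rewrite sat_exs in H; destruct H as [X H]; exists X; intro n.
  specialize (H n); rewrite sat_iff, sat_shifts in H.
  change (vmem n X <-> sat (scons n (fun k : nat => match v k with
     | inl _ => 0 | inr x => x end)) r A') in H.
  rewrite H; unfold A'; rewrite sat_subst.
  rewrite <- (HP (scons n (fun _ => 0))).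
  match goal with |- sat ?a _ _ <-> sat ?b _ _ =>
    replace a with b; [reflexivity|] end.
  apply functional_extensionality; intro k; unfold assign.
  destruct (v k) as [[|i]|y] eqn:F; cbn; rewrite ?F; reflexivity.
Qed.

Lemma sat_ax A (H : ACA0 A) X : sat (fun _ => vzero M) (fun _ => X) A.
Proof. now apply HM. Qed.

Lemma succ_neq0 n : n + 1 <> 0.
Proof. destruct HS as [X]; exact (sat_ax aca_succ_neq0 X n). Qed.

Lemma succ_inj m n : m + 1 = n + 1 -> m = n.
Proof. destruct HS as [X]; exact (sat_ax aca_succ_inj X m n). Qed.

Lemma vadd0 m : m + 0 = m.
Proof. destruct HS as [X]; exact (sat_ax aca_add0 X m). Qed.

Lemma vaddS m n : m + (n + 1) = (m + n) + 1.
Proof. destruct HS as [X]; exact (sat_ax aca_addS X m n). Qed.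

Lemma vmul0 m : m * 0 = 0.
Proof. destruct HS as [X]; exact (sat_ax aca_mul0 X m). Qed.

Lemma vmulS m n : m * (n + 1) = m * n + m.
Proof. destruct HS as [X]; exact (sat_ax aca_mulS X m n). Qed.

Lemma vlt0 m : ~ m < 0.
Proof. destruct HS as [X]; exact (sat_ax aca_lt0 X m). Qed.

Lemma vltS m n : m < n + 1 <-> m <= n.
Proof.
  destruct HS as [X]; generalize (sat_ax aca_ltS X m n).
  cbn; tauto.
Qed.

(** The axiom speaks of sets only; comprehension turns it into induction for arithmetical
    conditions. *)
Lemma induction (P : dom M -> Prop) :
  definable (fun e => P (e O)) ->
  P 0 -> (forall n, P n -> P (n + 1)) -> forall n, P n.
Proof.
  intros HP H0 H1.
  destruct (comprehension HP) as [X HX].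
  assert (K := sat_ax aca_induction X X); cbn in K.
  intro n; apply HX, K.
  intro L; apply L; [now apply HX|].
  intros k Hk; apply HX, H1, HX, Hk.
Qed.

Ltac induct n :=
  revert n;
  match goal with |- forall x, @?P x => apply (induction (P := P)) end;
  [definability | | intro n].

Lemma vadd0l n : 0 + n = n.
Proof.
  induct n; [apply vadd0|]; intro IH; now rewrite vaddS, IH.
Qed.

Lemma vaddSl m n : (m + 1) + n = (m + n) + 1.
Proof.
  induct n; [now rewrite !vadd0|]; intro IH; now rewrite !vaddS, IH.
Qed.

Lemma vadd_comm m n : m + n = n + m.
Proof.
  induct n; [now rewrite vadd0, vadd0l|]; intro IH; now rewrite vaddS, vaddSl, IH.
Qed.

Lemma vadd_assoc m n p : m + (n + p) = (m + n) + p.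
Proof.
  induct p; [now rewrite !vadd0|]; intro IH; now rewrite !vaddS, IH.
Qed.

Lemma vmul0l n : 0 * n = 0.
Proof.
  induct n; [apply vmul0|]; intro IH; now rewrite vmulS, IH, vadd0.
Qed.

Lemma vmulSl m n : (m + 1) * n = m * n + n.
Proof.
  induct n; [now rewrite !vmul0, vadd0|]; intro IH.
  rewrite !vmulS, IH, <- !vadd_assoc; f_equal.
  now rewrite !vaddS, (vadd_comm n m).
Qed.

Lemma vmul_comm m n : m * n = n * m.
Proof.
  induct n; [now rewrite vmul0, vmul0l|]; intro IH; now rewrite vmulS, vmulSl, IH.
Qed.

Lemma vmul_distr m n p : (m + n) * p = m * p + n * p.
Proof.
  induct p; [now rewrite !vmul0, vadd0|]; intro IH.
  rewrite !vmulS, IH, <- !vadd_assoc; f_equal.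
  now rewrite !vadd_assoc, (vadd_comm m).
Qed.

Lemma vmul_assoc m n p : m * (n * p) = (m * n) * p.
Proof.
  induct p; [now rewrite !vmul0|]; intro IH.
  rewrite !vmulS, <- IH, vmul_comm, vmul_distr; f_equal; apply vmul_comm.
Qed.

Lemma dom_semiring :
  semi_ring_theory 0 1 (@vadd M) (@vmul M) eq.
Proof.
  split; intros.
  - apply vadd0l.
  - apply vadd_comm.
  - apply vadd_assoc.
  - now rewrite <- (vadd0l 1), vmulSl, vmul0l, vadd0l.
  - apply vmul0l.
  - apply vmul_comm.
  - apply vmul_assoc.
  - apply vmul_distr.
Qed.

Add Ring dom_ring : dom_semiring.

Lemma vadd_cancel m n p : m + p = n + p -> m = n.
Proof.
  induct p; [now rewrite !vadd0|]; intros IH H.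
  rewrite !vaddS in H; auto using succ_inj.
Qed.

Lemma zero_or_succ n : n = 0 \/ exists m, n = m + 1.
Proof. induct n; [now left|]; intros _; right; now exists n. Qed.

Lemma vadd_self m n : m + n = n -> m = 0.
Proof. intro H; apply vadd_cancel with n; now rewrite vadd0l. Qed.

(** Inequalities become equations without subtraction, which [ring] can settle over the semiring. *)
Lemma vlt_def m n : m < n <-> exists c, n = m + c + 1.
Proof.
  induct n.
  - split; [intro H; now apply vlt0 in H|].
    intros [c H]; symmetry in H; now apply succ_neq0 in H.
  - intro IH; rewrite vltS, IH; split.
    + intros [[c ->]| ->]; [exists (c + 1) | exists 0]; ring.
    + intros [c H]; apply succ_inj in H as ->.
      destruct (zero_or_succ c) as [->|[k ->]]; [right; ring|].
      left; exists k; ring.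
Qed.

Lemma vle_def m n : m <= n <-> exists c, n = m + c.
Proof.
  rewrite <- vltS, vlt_def; split; intros [c H]; exists c.
  - now apply succ_inj in H.
  - now rewrite H.
Qed.

Lemma vlt_le m n : m < n <-> m + 1 <= n.
Proof.
  rewrite vlt_def, vle_def; split; intros [c ->]; exists c; ring.
Qed.

Lemma vlt_irrefl n : ~ n < n.
Proof.
  rewrite vlt_def; intros [c H].
  assert (K : c + 1 = 0) by (apply vadd_self with n; etransitivity; [|symmetry; exact H]; ring).
  now apply succ_neq0 in K.
Qed.

Lemma vlt_trichotomy m n : m < n \/ m = n \/ n < m.
Proof.
  induct n.
  - destruct (zero_or_succ m) as [->|[k ->]]; [auto|].
    right; right; apply vlt_def; exists k; ring.
  - rewrite vltS; intros [H|[H|H]]; [tauto|tauto|].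
    apply vlt_le in H; destruct H as [H| ->]; tauto.
Qed.

Lemma vle_refl n : n <= n.
Proof. now right. Qed.

Lemma vle_trans m n p : m <= n -> n <= p -> m <= p.
Proof.
  rewrite !vle_def; intros [c ->] [d ->]; exists (c + d); ring.
Qed.

Lemma vlt_le_trans m n p : m < n -> n <= p -> m < p.
Proof.
  rewrite vle_def, !vlt_def; intros [c ->] [d ->]; exists (c + d); ring.
Qed.

Lemma vle_lt_trans m n p : m <= n -> n < p -> m < p.
Proof.
  rewrite vle_def, !vlt_def; intros [c ->] [d ->]; exists (c + d); ring.
Qed.

Lemma vlt_not_le m n : m < n <-> ~ n <= m.
Proof.
  split.
  - intros H K; apply (@vlt_irrefl m); eapply vlt_le_trans; eauto.
  - destruct (vlt_trichotomy m n) as [|[->|]]; tauto.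
Qed.

Lemma vle_not_lt m n : m <= n <-> ~ n < m.
Proof. rewrite (vlt_not_le n m); tauto. Qed.

Lemma vle_total m n : m <= n \/ n <= m.
Proof. destruct (vlt_trichotomy m n) as [|[|]]; auto. Qed.

Lemma vle0 n : 0 <= n.
Proof. apply vle_def; exists n; ring. Qed.

Lemma vlt_succ n : n < n + 1.
Proof. apply vltS, vle_refl. Qed.

Lemma vle_addr m n : m <= m + n.
Proof. apply vle_def; now exists n. Qed.

Lemma vle_addl m n : m <= n + m.
Proof. apply vle_def; exists n; ring. Qed.

Lemma vle_add m n p q : m <= n -> p <= q -> m + p <= n + q.
Proof. rewrite !vle_def; intros [c ->] [d ->]; exists (c + d); ring. Qed.

Lemma vpos_succ n : 0 < n <-> exists m, n = m + 1.
Proof. rewrite vlt_def; split; intros [c ->]; exists c; ring. Qed.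

(** Least elements serve as definable choices: of the index where points separate, of codes for
    initial segments, and of counterexamples. *)
Lemma least (P : dom M -> Prop) :
  definable (fun e => P (e O)) -> (exists n, P n) ->
  exists n, P n /\ forall m, m < n -> ~ P m.
Proof.
  intros HP [n Hn]; apply NNPP; intro K.
  assert (H : forall k, forall m, m <= k -> ~ P m).
  { intro k; induct k.
    - intros m [H| ->] Hm; [now apply vlt0 in H|].
      apply K; exists 0; split; [exact Hm|]; intros m H; now apply vlt0 in H.
    - intros IH m [H| ->] Hm; [apply vltS in H; now apply (IH m)|].
      apply K; exists (k + 1); split; [exact Hm|].
      intros m H; apply vltS in H; now apply IH. }
  exact (H n n (vle_refl n) Hn).
Qed.

(** ** Division, pairs and parity *)

Lemma division d n : 0 < d -> exists q r, r < d /\ n = q * d + r.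
Proof.
  intro Hd; induct n.
  - exists 0, 0; split; [exact Hd | ring].
  - intros [q [r [H E]]]; apply vlt_le in H as [H|H].
    + exists q, (r + 1); split; [exact H|]; rewrite E; ring.
    + exists (q + 1), 0; split; [exact Hd|]; rewrite E, <- H; ring.
Qed.

Lemma division_unique d q r q' r' :
  r < d -> r' < d -> q * d + r = q' * d + r' -> r = r'.
Proof.
  assert (K : forall q r q' r', r < d -> q < q' -> q * d + r <> q' * d + r').
  { clear - HS HM; intros q r q' r' H Hq E.
    apply vlt_def in Hq as [c ->].
    apply vlt_not_le in H; apply H, vle_def; exists (c * d + r').
    apply vadd_cancel with (q * d); rewrite vadd_comm, E; ring. }
  intros H H' E; destruct (vlt_trichotomy q q') as [Hq|[->|Hq]].
  - exfalso; eapply K; [| |exact E]; auto.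
  - apply vadd_cancel with (q' * d); now rewrite vadd_comm, E, vadd_comm.
  - exfalso; eapply K; [| |symmetry; exact E]; auto.
Qed.

Definition vpair x y : dom M := (x + y) * (x + y) + x.

(** The pair code is at least the square of x + y and below the next square, so it determines x + y,
    and then x. *)
Lemma vpair_inj x y x' y' : vpair x y = vpair x' y' -> x = x' /\ y = y'.
Proof.
  unfold vpair; intro H.
  assert (K : forall x y x' y', (x + y) * (x + y) + x = (x' + y') * (x' + y') + x'
            -> ~ x + y < x' + y').
  { clear - HS HM; intros x y x' y' E H; apply vlt_def in H as [c H]; rewrite H in E.
    assert (F : x' + y + c + (x + y) * (c + c) + c * (c + 1) + (x + y) + 1 = 0).
    { apply vadd_self with ((x + y) * (x + y) + x).
      etransitivity; [|symmetry; exact E]; ring. }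
    now apply succ_neq0 in F. }
  assert (E : x + y = x' + y').
  { destruct (vlt_trichotomy (x + y) (x' + y')) as [L|[L|L]]; [|exact L|].
    - now apply K in L.
    - now apply K in L. }
  rewrite E in H; rewrite !(vadd_comm ((x' + y') * (x' + y'))) in H.
  apply vadd_cancel in H as ->; split; [reflexivity|].
  rewrite !(vadd_comm x') in E; now apply vadd_cancel in E.
Qed.

Lemma double_inj x y : x + x = y + y -> x = y.
Proof.
  assert (K : forall x y, x < y -> x + x <> y + y).
  { clear - HS HM; intros x y H E; apply vlt_def in H as [c ->].
    assert (F : c + c + 1 + 1 = 0).
    { apply vadd_self with (x + x).
      etransitivity; [|symmetry; exact E]; ring. }
    now apply succ_neq0 in F. }
  intro E; destruct (vlt_trichotomy x y) as [H|[H|H]]; [|exact H|];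
    apply K in H; congruence.
Qed.

Lemma double_neq_double_succ x y : x + x <> y + y + 1.
Proof.
  intro E; destruct (vle_total x y) as [H|H]; apply vle_def in H as [c ->].
  - assert (F : c + c + 1 = 0).
    { apply vadd_self with (x + x).
      etransitivity; [|symmetry; exact E]; ring. }
    now apply succ_neq0 in F.
  - assert (F : c + c = 1).
    { apply vadd_cancel with (y + y).
      transitivity (y + c + (y + c)); [|rewrite E]; ring. }
    destruct (zero_or_succ c) as [->|[d ->]].
    + rewrite vadd0 in F; apply (@succ_neq0 0); now rewrite vadd0l.
    + assert (G : d + d + 1 = 0) by
        (apply succ_inj; rewrite vadd0l; etransitivity; [|exact F]; ring).
      now apply succ_neq0 in G.
Qed.

(** ** The beta function *)

Definition vbeta a b i r : Prop :=
  r < 1 + (i + 1) * b /\ exists q, a = q * (1 + (i + 1) * b) + r.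

Lemma vbeta_total a b i : exists r, vbeta a b i r.
Proof.
  destruct (@division (1 + (i + 1) * b) a) as [q [r [H E]]].
  - apply vpos_succ; exists ((i + 1) * b); ring.
  - exists r; split; [exact H | now exists q].
Qed.

Lemma vbeta_fun a b i r r' : vbeta a b i r -> vbeta a b i r' -> r = r'.
Proof.
  intros [H [q E]] [H' [q' E']]; apply (division_unique H H' (q := q) (q' := q')); congruence.
Qed.

(** This number plays the role of n!, for which the language has no term. *)
Lemma common_multiple n :
  exists b, 0 < b /\ forall i, i < n -> exists q, b = (i + 1) * q.
Proof.
  induct n.
  - exists 1; split; [apply vpos_succ; exists 0; ring|].
    intros i H; now apply vlt0 in H.
  - intros [b [Hb H]]; apply vpos_succ in Hb as [c ->].
    exists ((c + 1) * (n + 1)); split.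
    + apply vpos_succ; exists (c * n + c + n); ring.
    + intros i Hi; apply vltS in Hi as [Hi| ->].
      * destruct (H i Hi) as [q ->]; exists (q * (n + 1)); ring.
      * exists (c + 1); ring.
Qed.

(** Bezout's identity without subtraction: u is invertible modulo v. *)
Definition vcoprime u v : Prop := exists x y, u * x = v * y + 1.

Lemma vcoprime_mul u u' v : vcoprime u v -> vcoprime u' v -> vcoprime (u * u') v.
Proof.
  intros [x [y H]] [x' [y' H']]; exists (x * x'), (v * y * y' + y + y').
  transitivity ((u * x) * (u' * x')); [ring|]; rewrite H, H'; ring.
Qed.

(* From [u X = -1 mod v] to [u X' = 1 mod v], with X' = (v - 1) X. *)
Lemma vcoprime_neg u w X Y :
  0 < w -> u * X + 1 = (w + 1) * (Y + 1) -> vcoprime u (w + 1).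
Proof.
  intros Hw H; apply vpos_succ in Hw as [w' ->].
  exists (X * (w' + 1)), (Y * w' + Y + w').
  apply vadd_cancel with (w' + 1).
  transitivity ((u * X + 1) * (w' + 1)); [ring|]; rewrite H; ring.
Qed.

(** Write u and v for the moduli and j = i + d + 1. Then (j + 1) u - (i + 1) v = d + 1, and d + 1
    divides b, say b = (d + 1) e. Multiplying by (j + 1) e expresses (j + 1) b = v - 1 through u and
    v. *)
Lemma vcoprime_moduli b i j n :
  0 < b -> (forall k, k < n -> exists q, b = (k + 1) * q) -> i < j -> j < n ->
  vcoprime (1 + (i + 1) * b) (1 + (j + 1) * b).
Proof.
  intros Hb H Hij Hj; apply vlt_def in Hij as [d ->].
  destruct (H d) as [e E].
  { eapply vle_lt_trans; [|exact Hj]; apply vle_def; exists (i + 1); ring. }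
  rewrite (vadd_comm 1 ((i + d + 1 + 1) * b)).
  apply vcoprime_neg with (X := (i + d + 1 + 1) * (i + d + 1 + 1) * e)
    (Y := (i + d + 1 + 1) * e * (i + 1)).
  - apply vpos_succ in Hb as [c ->]; apply vpos_succ.
    exists ((i + d + 1) * (c + 1) + c); ring.
  - rewrite E; ring.
Qed.

(** Goedel's lemma by the Chinese remainder theorem. The relation [f] may be partial: a position
    without a value only enlarges the modulus. *)
Lemma vbeta_lemma (f : dom M -> dom M -> Prop) n :
  definable (fun e => f (e 0%nat) (e 1%nat)) ->
  (forall i y y', f i y -> f i y' -> y = y') ->
  exists a b, forall i y, i < n -> f i y -> vbeta a b i y.
Proof.
  intros Hf Hfun.
  assert (Hm : exists m, forall i y, i < n -> f i y -> y < m).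
  { assert (K : forall k, exists m, forall i y, i < k -> f i y -> y < m).
    { intro k; induct k.
      - exists 0; intros i y H; now apply vlt0 in H.
      - intros [m Hm]; destruct (classic (exists y, f k y)) as [[y Hy]|Hy].
        + exists (m + (y + 1)); intros i z Hi Hz; apply vltS in Hi as [Hi| ->].
          * eapply vlt_le_trans; [exact (Hm i z Hi Hz) | apply vle_addr].
          * rewrite (Hfun _ _ _ Hz Hy), vadd_assoc; apply vltS, vle_addl.
        + exists m; intros i z Hi Hz; apply vltS in Hi as [Hi| ->]; eauto.
          destruct Hy; eauto. }
    apply K. }
  destruct Hm as [m Hm], (common_multiple n) as [b0 [Hb0 Hdiv]].
  (* The factor [b0] makes the moduli coprime; the factor m + 1 makes them exceed all values to be
     coded. *)
  set (b := b0 * (m + 1)).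
  assert (Hb : 0 < b).
  { apply vpos_succ in Hb0 as [c ->]; apply vpos_succ.
    exists (c * m + c + m); unfold b; ring. }
  assert (Hdiv' : forall i, i < n -> exists q, b = (i + 1) * q).
  { intros i Hi; destruct (Hdiv i Hi) as [q E].
    exists (q * (m + 1)); unfold b; rewrite E; ring. }
  assert (Hsmall : forall i, m <= (i + 1) * b).
  { intro i; apply vpos_succ in Hb0 as [c E]; apply vle_def.
    exists (i * b + c * (m + 1) + 1); unfold b; rewrite E; ring. }
  (* So far [a] has the first k remainders; [c] is a common multiple of the first k moduli and
     invertible modulo the later ones. *)
  assert (CRT : forall k, k <= n -> exists a c,
    (forall i y, i < k -> f i y -> exists q, a = q * (1 + (i + 1) * b) + y) /\
    (forall i, i < k -> exists q, c = q * (1 + (i + 1) * b)) /\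
    (forall j, k <= j -> j < n ->
       exists x y, c * x = (1 + (j + 1) * b) * y + 1)).
  { intro k; induct k.
    - intros _; exists 0, 1; split; [|split].
      + intros i y H; now apply vlt0 in H.
      + intros i H; now apply vlt0 in H.
      + intros; exists 1, 0; ring.
    - intros IH Hk; apply vlt_le in Hk.
      destruct IH as [a [c [Ha [Hc Hcop]]]]; [now left|].
      assert (Hc' : forall i, i < k + 1 -> exists q,
                c * (1 + (k + 1) * b) = q * (1 + (i + 1) * b)).
      { intros i Hi; apply vltS in Hi as [Hi| ->]; [|now exists c].
        destruct (Hc i Hi) as [q ->].
        exists (q * (1 + (k + 1) * b)); ring. }
      assert (Hcop' : forall j, k + 1 <= j -> j < n ->
                vcoprime (c * (1 + (k + 1) * b)) (1 + (j + 1) * b)).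
      { intros j Hj Hjn; apply vlt_le in Hj; apply vcoprime_mul.
        - apply Hcop; [now left | exact Hjn].
        - eapply vcoprime_moduli; eauto. }
      destruct (classic (exists y, f k y)) as [[y Hy]|Hy].
      + destruct (Hcop k (vle_refl k) Hk) as [x [z E]].
        (* Modulo the new modulus, c x is 1 and (k + 1) b is -1, so the remainder is a + y - a = y.
           The added term is a multiple of c, which preserves the earlier remainders. *)
        exists (a + c * (x * (y + a * ((k + 1) * b)))), (c * (1 + (k + 1) * b)).
        split; [|split; assumption].
        intros i y' Hi Hy'; apply vltS in Hi as [Hi| ->].
        * destruct (Ha i y' Hi Hy') as [q Hq], (Hc i Hi) as [q' Hq'].
          exists (q + q' * (x * (y + a * ((k + 1) * b)))).
          rewrite Hq at 1; rewrite Hq' at 1; ring.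
        * rewrite (Hfun _ _ _ Hy' Hy).
          exists (a + z * (y + a * ((k + 1) * b))).
          transitivity (a + (c * x) * (y + a * ((k + 1) * b))); [ring|].
          rewrite E; ring.
      + exists a, (c * (1 + (k + 1) * b)); split; [|split; assumption].
        intros i y Hi Hy'; apply vltS in Hi as [Hi| ->]; [now apply Ha|].
        destruct Hy; eauto. }
  destruct (CRT n (vle_refl n)) as [a [c [Ha _]]].
  exists a, b; intros i y Hi Hy; split; [|now apply Ha].
  eapply vlt_le_trans; [exact (Hm i y Hi Hy)|].
  eapply vle_trans; [apply (Hsmall i) | apply vle_addl].
Qed.

Definition vpow2 k y : Prop :=
  exists a b, vbeta a b 0 1 /\
    (forall i r, i < k -> vbeta a b i r -> vbeta a b (i + 1) ((1 + 1) * r)) /\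
    vbeta a b k y.

Lemma vpow2_zero : vpow2 0 1.
Proof.
  exists 1, 1.
  assert (K : vbeta 1 1 0 1).
  { split; [|exists 0; ring]; apply vlt_def; exists 0; ring. }
  repeat split; try apply K.
  - apply vlt0 in H; tauto.
  - now apply vlt0 in H.
Qed.

(** A code cannot be prolonged in place: the beta lemma produces a new one that copies the old
    values up to k and appends 2u. *)
Lemma vpow2_succ k u : vpow2 k u -> vpow2 (k + 1) ((1 + 1) * u).
Proof.
  intros [a [b [H0 [H1 H2]]]].
  destruct (@vbeta_lemma
    (fun i y => i <= k /\ (y < 1 + (i + 1) * b /\ exists q, a = q * (1 + (i + 1) * b) + y)
       \/ i = k + 1 /\ y = (1 + 1) * u) (k + 1 + 1)) as [a' [b' H]].
  - definability.
  - intros i y y' [[Hi Hy]|[-> ->]] [[Hi' Hy']|[E ->]].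
    + eapply vbeta_fun; eauto.
    + subst i; apply vltS, vlt_irrefl in Hi; tauto.
    + apply vltS, vlt_irrefl in Hi'; tauto.
    + reflexivity.
  - exists a', b'; split; [|split].
    + apply H; [apply vltS, vle0|]; left; split; [apply vle0 | exact H0].
    + intros i r Hi Hr; destruct (vbeta_total a b i) as [s Hs].
      apply vltS in Hi.
      assert (E : r = s).
      { eapply vbeta_fun; [exact Hr|]; apply H; [|now left].
        apply vltS; left; now apply vltS. }
      subst r; apply H.
      { rewrite vltS; apply vle_add; [exact Hi | apply vle_refl]. }
      destruct Hi as [Hi| ->].
      * left; split; [now apply vlt_le | now apply H1].
      * right; split; [reflexivity|]; now rewrite (vbeta_fun Hs H2).
    + apply H; [apply vlt_succ | right; auto].
Qed.

(** Comparison of reals leaves a slack of 2/2^k, so refuting a comparison requires 2^k to be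
    large. *)
Lemma vpow2_unbounded m : exists k u, vpow2 k u /\ m < u.
Proof.
  (* The power is spelled out so that the definability tactic sees its quantifiers. *)
  assert (K : exists k u, (exists a b, vbeta a b 0 1 /\
    (forall i r, i < k -> vbeta a b i r -> vbeta a b (i + 1) ((1 + 1) * r)) /\
    vbeta a b k u) /\ m < u); [|exact K].
  unfold vbeta; induct m.
  - exists 0, 1; split; [apply vpow2_zero|]; apply vpos_succ; exists 0; ring.
  - intros [k [u [H Hu]]]; exists (k + 1), ((1 + 1) * u).
    split; [now apply vpow2_succ|].
    apply vlt_def in Hu as [c ->]; apply vlt_def; exists (m + c + c); ring.
Qed.

(** * The metric space of a relation *)

(** ** Interpretation of the formulas on metric spaces *)

Record vrat := VRat { vpos : dom M; vneg : dom M; vden : dom M }.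

Definition vrcode (p : vrat) : dom M := vpair (vpair (vpos p) (vneg p)) (vden p).
Definition vallrat (F : vrat -> Prop) : Prop :=
  forall a b c, 0 < c -> F (VRat a b c).
Definition vsomerat (F : vrat -> Prop) : Prop :=
  exists a b c, 0 < c /\ F (VRat a b c).
Definition vradd (p q : vrat) : vrat :=
  VRat (vpos p * vden q + vpos q * vden p) (vneg p * vden q + vneg q * vden p)
    (vden p * vden q).
Definition vrle (p q : vrat) : Prop :=
  vpos p * vden q + vneg q * vden p <= vpos q * vden p + vneg p * vden q.
Definition vrclose (p q e : vrat) : Prop := vrle p (vradd q e) /\ vrle q (vradd p e).

Definition vreal := dom M -> vrat -> Prop.

Definition vis_real (R : vreal) : Prop :=
  (forall k, vsomerat (fun p : vrat => R k p)) /\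
  (forall k, vallrat (fun p : vrat => vallrat (fun q : vrat =>
     R k p /\ R k q -> vrcode p = vrcode q))) /\
  (forall k i u, vallrat (fun p : vrat => vallrat (fun q : vrat =>
     vpow2 k u /\ R k p /\ R (k + i) q -> vrclose p q (VRat 1 0 u)))).

Definition vreal_of_rat (p : vrat) : vreal := fun _ (q : vrat) => vrcode q = vrcode p.
Definition vreal_add (R S : vreal) : vreal := fun k (r : vrat) =>
  vsomerat (fun p : vrat => vsomerat (fun q : vrat =>
    R (k + 1) p /\ S (k + 1) q /\ vrcode r = vrcode (vradd p q))).
Definition vreal_eq (R S : vreal) : Prop :=
  forall k u, vallrat (fun p : vrat => vallrat (fun q : vrat =>
    vpow2 k u /\ R k p /\ S k q -> vrclose p q (VRat (1 + 1) 0 u))).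
Definition vreal_le (R S : vreal) : Prop :=
  forall k u, vallrat (fun p : vrat => vallrat (fun q : vrat =>
    vpow2 k u /\ R k p /\ S k q -> vrle p (vradd q (VRat (1 + 1) 0 u)))).
Definition vreal_lt (R S : vreal) : Prop := ~ vreal_le S R.

Definition vspace (X : sets M) x : Prop := vmem (x + x) X.
Definition vdist (X : sets M) x y : vreal := fun k (q : vrat) =>
  vmem (vpair (vpair (vpair x y) k) (vrcode q)
        + vpair (vpair (vpair x y) k) (vrcode q) + 1) X.

Definition vmetric_space (X : sets M) : Prop :=
  (forall z, vmem (z + z + 1) X ->
     exists x y k, vsomerat (fun q : vrat => vspace X x /\ vspace X y /\
       z = vpair (vpair (vpair x y) k) (vrcode q))) /\
  (forall x y, vspace X x /\ vspace X y -> vis_real (vdist X x y)) /\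
  (forall x y, vspace X x /\ vspace X y ->
     vreal_le (vreal_of_rat (VRat 0 0 1)) (vdist X x y)) /\
  (forall x y, vspace X x /\ vspace X y ->
     (vreal_eq (vdist X x y) (vreal_of_rat (VRat 0 0 1)) <-> x = y)) /\
  (forall x y, vspace X x /\ vspace X y ->
     vreal_eq (vdist X x y) (vdist X y x)) /\
  (forall x y z, vspace X x /\ vspace X y /\ vspace X z ->
     vreal_le (vdist X x z) (vreal_add (vdist X x y) (vdist X y z))).

Definition vis_sequence (X S : sets M) : Prop :=
  (forall z, vmem z S -> exists n x, vspace X x /\ z = vpair n x) /\
  (forall n, exists x, vmem (vpair n x) S) /\
  (forall n x y, vmem (vpair n x) S /\ vmem (vpair n y) S -> x = y).

Definition vis_cauchy (X S : sets M) : Prop :=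
  vallrat (fun e : vrat => vneg e < vpos e ->
    exists N, forall m n x y,
      N <= m /\ N <= n /\ vmem (vpair m x) S /\ vmem (vpair n y) S ->
      vreal_lt (vdist X x y) (vreal_of_rat e)).

Definition vconverges_to (X S : sets M) l : Prop :=
  vallrat (fun e : vrat => vneg e < vpos e ->
    exists N, forall n x, N <= n /\ vmem (vpair n x) S ->
      vreal_lt (vdist X x l) (vreal_of_rat e)).

Definition vcomplete (X : sets M) : Prop :=
  forall S, vis_sequence X S /\ vis_cauchy X S ->
    exists l, vspace X l /\ vconverges_to X S l.

Lemma sat_countable_metric_space e (r : nat -> sets M) :
  sat e r countable_metric_space <-> vmetric_space (r O).
Proof. unfold_form; reflect_sat. Qed.

Lemma sat_complete e (r : nat -> sets M) : sat e r complete <-> vcomplete (r O).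
Proof. unfold_form; reflect_sat. Qed.

(** * Metric and separation for an arbitrary relation *)

Section Space.

Variable R : dom M -> dom M -> dom M -> dom M -> dom M -> dom M -> Prop.

Definition vnode x : Prop :=
  exists a b n, x = vpair (vpair a b) n /\
    forall y3 i3 y2 i2 y1 i1,
      i1 < n /\ vbeta a b i1 y1 /\ i2 < n /\ vbeta a b i2 y2 /\
      i3 < n /\ vbeta a b i3 y3 -> R i1 y1 i2 y2 i3 y3.

Definition vagree x y k : Prop :=
  exists a b n a' b' n',
    x = vpair (vpair a b) n /\ y = vpair (vpair a' b') n' /\
    k <= n /\ k <= n' /\
    forall i v, i < k -> (vbeta a b i v <-> vbeta a' b' i v).

Definition vseparation x y k : Prop :=
  ~ vagree x y k /\ forall j, j < k -> vagree x y j.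

Definition vdistance x y q : Prop :=
  (x = y /\ q = vrcode (VRat 0 0 1)) \/
  (~ x = y /\ exists k, vseparation x y k /\ q = vrcode (VRat 1 0 k)).

Definition vspace_elt w : Prop :=
  (exists x, w = x + x /\ vnode x) \/
  (exists x y k q, w = vpair (vpair (vpair x y) k) q
                      + vpair (vpair (vpair x y) k) q + 1 /\
     vnode x /\ vnode y /\ vdistance x y q).

Lemma sat_space_form rho e (r : nat -> sets M) :
  (forall e, sat e r rho <->
     R (e 0%nat) (e 1%nat) (e 2%nat) (e 3%nat) (e 4%nat) (e 5%nat)) ->
  sat e r (space_form rho) <-> vspace_elt (e 0%nat).
Proof. intro H; unfold_form; reflect_sat; apply H. Qed.

Lemma vnode_pair x : vnode x -> exists a b n, x = vpair (vpair a b) n.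
Proof. intros [a [b [n [H _]]]]; eauto. Qed.

Lemma vnode_inv a b n : vnode (vpair (vpair a b) n) ->
  forall i1 y1 i2 y2 i3 y3,
    i1 < n -> vbeta a b i1 y1 -> i2 < n -> vbeta a b i2 y2 ->
    i3 < n -> vbeta a b i3 y3 -> R i1 y1 i2 y2 i3 y3.
Proof.
  intros [a' [b' [n' [E H]]]].
  apply vpair_inj in E as [E ->]; apply vpair_inj in E as [-> ->].
  intros; apply H; tauto.
Qed.

Lemma vagree_inv a b n a' b' n' k :
  vagree (vpair (vpair a b) n) (vpair (vpair a' b') n') k <->
  k <= n /\ k <= n' /\
  forall i v, i < k -> (vbeta a b i v <-> vbeta a' b' i v).
Proof.
  split.
  - intros [a0 [b0 [n0 [a0' [b0' [n0' [E [E' H]]]]]]]].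
    apply vpair_inj in E as [E ->]; apply vpair_inj in E as [-> ->].
    apply vpair_inj in E' as [E' ->]; apply vpair_inj in E' as [-> ->].
    exact H.
  - intro H; exists a, b, n, a', b', n'; auto.
Qed.

Lemma vagree_le x y j k : j <= k -> vagree x y k -> vagree x y j.
Proof.
  intros Hj [a [b [n [a' [b' [n' [-> [-> H]]]]]]]].
  apply vagree_inv; destruct H as [H1 [H2 H3]].
  split; [eapply vle_trans; eauto|]; split; [eapply vle_trans; eauto|].
  intros i v Hi; apply H3; eapply vlt_le_trans; eauto.
Qed.

Lemma vagree_sym x y k : vagree x y k -> vagree y x k.
Proof.
  intros [a [b [n [a' [b' [n' [-> [-> H]]]]]]]].
  apply vagree_inv; destruct H as [H1 [H2 H3]]; repeat split; auto;
    now apply H3.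
Qed.

Lemma vagree_trans x y z k : vagree x y k -> vagree y z k -> vagree x z k.
Proof.
  intros [a [b [n [a' [b' [n' [-> [-> H]]]]]]]] K.
  destruct K as [a1 [b1 [n1 [a2 [b2 [n2 [E [-> K]]]]]]]].
  apply vpair_inj in E as [E ->]; apply vpair_inj in E as [-> ->].
  apply vagree_inv; destruct H as [H1 [H2 H3]], K as [K1 [K2 K3]].
  split; [exact H1|]; split; [exact K2|].
  intros i v Hi; now rewrite H3, K3.
Qed.

Lemma vagree_zero x y : vnode x -> vnode y -> vagree x y 0.
Proof.
  intros Hx Hy; apply vnode_pair in Hx as [a [b [n ->]]].
  apply vnode_pair in Hy as [a' [b' [n' ->]]].
  apply vagree_inv; split; [apply vle0|]; split; [apply vle0|].
  intros i v Hi; now apply vlt0 in Hi.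
Qed.

Lemma vseparation_fun x y k k' : vseparation x y k -> vseparation x y k' -> k = k'.
Proof.
  intros [H1 H2] [K1 K2].
  destruct (vlt_trichotomy k k') as [H|[H|H]]; [|exact H|]; exfalso; auto.
Qed.

Lemma vseparation_sym x y k : vseparation x y k -> vseparation y x k.
Proof.
  intros [H1 H2]; split.
  - intro H; now apply H1, vagree_sym.
  - intros j Hj; now apply vagree_sym, H2.
Qed.

(** Nothing agrees with x beyond the length of x, so there is a least index of disagreement. *)
Lemma vseparation_ex x y : vnode x -> exists k, vseparation x y k.
Proof.
  intro Hx; destruct (@least (fun k => ~ vagree x y k)) as [k [H1 H2]].
  - unfold vagree, vbeta, vpair; definability.
  - apply vnode_pair in Hx as [a [b [n ->]]]; exists (n + 1).
    intros [a0 [b0 [n0 [a0' [b0' [n0' [E [_ [H _]]]]]]]]].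
    apply vpair_inj in E as [_ <-]; now apply vlt_le, vlt_irrefl in H.
  - exists k; split; [exact H1|]; intros j Hj; apply NNPP; now apply H2.
Qed.

Lemma vseparation_pos x y k : vnode x -> vnode y -> vseparation x y k -> 0 < k.
Proof.
  intros Hx Hy [H _]; destruct (zero_or_succ k) as [->|Hk].
  - now destruct H; apply vagree_zero.
  - now apply vpos_succ.
Qed.

Lemma vrcode_inj (p q : vrat) : vrcode p = vrcode q -> p = q.
Proof.
  destruct p, q; unfold vrcode; cbn; intro H.
  apply vpair_inj in H as [H ->]; now apply vpair_inj in H as [-> ->].
Qed.

Definition vvalue x y (q : vrat) : Prop :=
  (x = y /\ q = VRat 0 0 1) \/
  (x <> y /\ exists k, vseparation x y k /\ q = VRat 1 0 k).

Lemma vvalue_distance x y (q : vrat) : vdistance x y (vrcode q) <-> vvalue x y q.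
Proof.
  unfold vdistance, vvalue; split; (intros [[H K]|[H [k [K L]]]]; [left|right]).
  - now apply vrcode_inj in K.
  - apply vrcode_inj in L; eauto.
  - now rewrite K.
  - split; [exact H|]; exists k; now rewrite L.
Qed.

Lemma vvalue_fun x y (p q : vrat) : vvalue x y p -> vvalue x y q -> p = q.
Proof.
  intros [[H ->]|[H [k [K ->]]]] [[H' ->]|[H' [k' [K' ->]]]]; try tauto.
  f_equal; eapply vseparation_fun; eauto.
Qed.

Lemma vvalue_sym x y (q : vrat) : vvalue x y q -> vvalue y x q.
Proof.
  intros [[H ->]|[H [k [K ->]]]]; [left|right]; split; auto.
  exists k; split; auto using vseparation_sym.
Qed.

Lemma vvalue_ex x y : vnode x -> vnode y ->
  exists a b c, 0 < c /\ vvalue x y (VRat a b c).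
Proof.
  intros Hx Hy; destruct (classic (x = y)) as [E|E].
  - exists 0, 0, 1; split; [|now left]; apply vpos_succ; exists 0; ring.
  - destruct (@vseparation_ex x y Hx) as [k Hk]; exists 1, 0, k; split.
    + exact (vseparation_pos Hx Hy Hk).
    + right; eauto.
Qed.

Lemma vrle_refl (p : vrat) : vrle p p.
Proof. now right. Qed.

(** Distances being constant sequences, most conditions on reals follow from exact inequalities of
    rationals, weakened by this slack. *)
Lemma vrle_slack (p q : vrat) c u : vrle p q -> vrle p (vradd q (VRat c 0 u)).
Proof.
  destruct p as [a b d], q as [a' b' d']; unfold vrle, vradd; cbn.
  rewrite !vle_def; intros [w E].
  exists (w * u + c * d' * d).
  transitivity ((a' * d + b * d') * u + c * d' * d); [ring|].
  rewrite E; ring.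
Qed.

Variable X : sets M.
Hypothesis HX : forall w, vmem w X <-> vspace_elt w.

Lemma vspace_node x : vspace X x <-> vnode x.
Proof.
  unfold vspace; rewrite HX; split.
  - intros [[x' [E H]]|[x1 [x2 [k [q [E _]]]]]].
    + now apply double_inj in E as ->.
    + now apply double_neq_double_succ in E.
  - intro H; left; eauto.
Qed.

Lemma vdist_value x y k (q : vrat) :
  vdist X x y k q <-> vnode x /\ vnode y /\ vvalue x y q.
Proof.
  unfold vdist; rewrite HX, <- vvalue_distance; split.
  - intros [[x' [E H]]|[x1 [x2 [k' [q' [E H]]]]]].
    + symmetry in E; now apply double_neq_double_succ in E.
    + apply vadd_cancel in E; apply double_inj in E.
      apply vpair_inj in E as [E <-]; apply vpair_inj in E as [E _].
      now apply vpair_inj in E as [<- <-].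
  - intro H; right; exists x, y, k, (vrcode q); auto.
Qed.

(** Agreement is transitive, so x and z separate no earlier than one of the pairs x, y and y, z. The
    distance is thus at most the larger of the other two, an ultrametric inequality. *)
Lemma vdist_triangle x y z (p q r : vrat) :
  vvalue x z p -> vvalue x y q -> vvalue y z r -> vrle p (vradd q r).
Proof.
  intros [[Hp ->]|[Hp [k [Kp ->]]]] Hq Hr.
  - assert (V : forall s : vrat, (exists x y, vvalue x y s) -> vneg s = 0).
    { intros s [x' [y' [[_ ->]|[_ [k [_ ->]]]]]]; reflexivity. }
    unfold vrle, vradd; cbn.
    rewrite (V q), (V r) by eauto; apply vle_def.
    exists (vpos q * vden r + vpos r * vden q); ring.
  - destruct Hq as [[<- ->]|[Hq [k1 [K1 ->]]]].
    { destruct Hr as [[Hr _]|[Hr [k2 [K2 ->]]]]; [tauto|].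
      rewrite (vseparation_fun Kp K2); unfold vrle, vradd; cbn.
      right; ring. }
    destruct Hr as [[<- ->]|[Hr [k2 [K2 ->]]]].
    { rewrite (vseparation_fun Kp K1); unfold vrle, vradd; cbn.
      right; ring. }
    assert (K : k1 <= k \/ k2 <= k).
    { rewrite !vle_not_lt; apply not_and_or; intros [L1 L2].
      apply Kp; apply vagree_trans with y; [now apply K1 | now apply K2]. }
    unfold vrle, vradd; cbn; rewrite vle_def.
    destruct K as [K|K]; apply vle_def in K as [g ->].
    + exists (k2 * g + k1 * (k1 + g)); ring.
    + exists (k1 * g + k2 * (k2 + g)); ring.
Qed.

Lemma metric_space_nodes : vmetric_space X.
Proof.
  split; [|split; [|split; [|split; [|split]]]].
  - intros z Hz; apply HX in Hz as [[x' [E H]]|[x [y [k [q [E [Hx [Hy H]]]]]]]].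
    + symmetry in E; now apply double_neq_double_succ in E.
    + apply vadd_cancel in E; apply double_inj in E.
      exists x, y, k.
      destruct (vvalue_ex Hx Hy) as [a [b [c [Hc V]]]]; exists a, b, c.
      split; [exact Hc|]; rewrite !vspace_node; split; [exact Hx|].
      split; [exact Hy|]; rewrite E; f_equal.
      apply vvalue_distance in V.
      destruct H as [[Exy ->]|[H [l [K ->]]]], V as [[Exy' ->]|[V [l' [K' ->]]]];
        try tauto.
      now rewrite (vseparation_fun K K').
  - intros x y [Hx Hy]; apply vspace_node in Hx, Hy; split; [|split].
    + intro k; destruct (vvalue_ex Hx Hy) as [a [b [c [Hc V]]]].
      exists a, b, c; split; [exact Hc|]; now apply vdist_value.
    + intros k a b c Hc a' b' c' Hc' [H H'].
      apply vdist_value in H, H'; f_equal; now apply (vvalue_fun (x := x) (y := y)).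
    + intros k i u a b c Hc a' b' c' Hc' [_ [H H']].
      apply vdist_value in H, H'.
      rewrite (vvalue_fun (x := x) (y := y) (p := VRat a b c) (q := VRat a' b' c'))
        by tauto.
      split; apply vrle_slack, vrle_refl.
  - intros x y [Hx Hy] k u a b c Hc a' b' c' Hc' [_ [H H']].
    apply vrcode_inj in H; rewrite H; apply vrle_slack.
    apply vdist_value in H' as [_ [_ [[_ ->]|[_ [l [_ ->]]]]]].
    + apply vrle_refl.
    + unfold vrle; cbn; apply vle_def; exists 1; ring.
  - intros x y [Hx Hy]; apply vspace_node in Hx, Hy; split.
    + intro H; apply NNPP; intro E.
      destruct (vseparation_ex y Hx) as [l Hl].
      (* Distinct points have distance 1/l, which exceeds the slack 2/2^k once 2^k > 2l. *)
      destruct (vpow2_unbounded ((1 + 1) * l)) as [k [u [Hu Hlt]]].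
      assert (Hl0 := vseparation_pos Hx Hy Hl).
      assert (H01 : 0 < 1) by (apply vpos_succ; exists 0; ring).
      destruct (H k u 1 0 l Hl0 0 0 1 H01) as [K _].
      { split; [exact Hu|]; split; [|reflexivity].
        apply vdist_value; split; [exact Hx|]; split; [exact Hy|].
        right; eauto. }
      unfold vrle, vradd in K; cbn in K.
      apply vlt_not_le in Hlt; apply Hlt; revert K.
      match goal with |- ?s <= ?t -> ?s' <= ?t' =>
        replace s with s' by ring; replace t with t' by ring; auto end.
    + intros <- k u a b c Hc a' b' c' Hc' [_ [H H']].
      apply vrcode_inj in H' as ->.
      apply vdist_value in H as [_ [_ [[_ ->]|[H _]]]]; [|tauto].
      split; apply vrle_slack, vrle_refl.
  - intros x y [Hx Hy] k u a b c Hc a' b' c' Hc' [_ [H H']].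
    apply vdist_value in H, H'.
    rewrite (vvalue_fun (x := x) (y := y) (p := VRat a b c) (q := VRat a' b' c')).
    + split; apply vrle_slack, vrle_refl.
    + tauto.
    + apply vvalue_sym; tauto.
  - intros x y z _ k u a b c Hc a' b' c' Hc'
      [_ [H [a1 [b1 [c1 [_ [a2 [b2 [c2 [_ [H1 [H2 E]]]]]]]]]]]].
    apply vdist_value in H as [_ [_ H]], H1 as [_ [_ H1]], H2 as [_ [_ H2]].
    apply vrcode_inj in E; rewrite E; apply vrle_slack.
    eapply vdist_triangle; eauto.
Qed.

(** The bound (a - b)/c is at least 1/c, while distinct points that agree up to c separate at some l
    > c and have distance 1/l. *)
Lemma dist_lt_of_agree x y a b c :
  vnode x -> vnode y -> 0 < c -> b < a -> x = y \/ vagree x y c ->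
  vreal_lt (vdist X x y) (vreal_of_rat (VRat a b c)).
Proof.
  intros Hx Hy Hc Hb H K; apply vlt_def in Hb as [d ->].
  destruct (classic (x = y)) as [E|E].
  - destruct (vpow2_unbounded ((1 + 1) * c)) as [k [u [Hu Hlt]]].
    assert (H01 : 0 < 1) by (apply vpos_succ; exists 0; ring).
    specialize (K k u (b + d + 1) b c Hc 0 0 1 H01).
    destruct (vle_def ((b + d + 1) * u) ((1 + 1) * c + b * u)) as [L _].
    destruct L as [w L].
    { unfold vrle, vradd in K; cbn in K.
      destruct K as [K|K].
      - split; [exact Hu|]; split; [reflexivity|]; apply vdist_value.
        split; [exact Hx|]; split; [exact Hy|]; now left.
      - left; revert K.
        match goal with |- ?s < ?t -> ?s' < ?t' =>
          replace s with s' by ring; replace t with t' by ring; auto end.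
      - right; etransitivity; [|etransitivity; [exact K|]]; ring. }
    apply vlt_not_le in Hlt; apply Hlt, vle_def; exists (d * u + w).
    apply vadd_cancel with (b * u); rewrite L; ring.
  - destruct H as [H|H]; [tauto|].
    destruct (vseparation_ex y Hx) as [l Hl].
    assert (Hl0 := vseparation_pos Hx Hy Hl).
    assert (Hcl : c < l).
    { apply vlt_not_le; intro L; apply Hl; eapply vagree_le; eauto. }
    apply vlt_def in Hcl as [f ->].
    (* With l = c + f + 1, the gap 1/c - 1/l is at least 1/(l c), so 2^k > 2 l c keeps the slack
       below it. *)
    destruct (vpow2_unbounded ((1 + 1) * (c + f + 1) * c)) as [k [u [Hu Hlt]]].
    specialize (K k u (b + d + 1) b c Hc 1 0 (c + f + 1) Hl0).
    destruct (vle_def ((b + d + 1) * ((c + f + 1) * u))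
      ((u + (1 + 1) * (c + f + 1)) * c + b * ((c + f + 1) * u))) as [L _].
    destruct L as [w L].
    { unfold vrle, vradd in K; cbn in K.
      destruct K as [K|K].
      - split; [exact Hu|]; split; [reflexivity|]; apply vdist_value.
        split; [exact Hx|]; split; [exact Hy|]; right; eauto.
      - left; revert K.
        match goal with |- ?s < ?t -> ?s' < ?t' =>
          replace s with s' by ring; replace t with t' by ring; auto end.
      - right; etransitivity; [|etransitivity; [exact K|]]; ring. }
    apply vlt_not_le in Hlt; apply Hlt, vle_def.
    exists (d * ((c + f + 1) * u) + f * u + w).
    apply vadd_cancel with (u * c + b * ((c + f + 1) * u)).
    transitivity ((u + (1 + 1) * (c + f + 1)) * c + b * ((c + f + 1) * u));
      [|rewrite L]; ring.
Qed.

Lemma agree_of_dist_lt x y c :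
  vnode x -> vnode y -> 0 < c ->
  vreal_lt (vdist X x y) (vreal_of_rat (VRat 1 0 c)) -> x = y \/ vagree x y c.
Proof.
  intros Hx Hy Hc H; apply NNPP; intro K; apply H.
  intros k u a b c' Hc' a' b' c1 Hc1 [_ [E V]].
  apply vrcode_inj in E; rewrite E; apply vrle_slack.
  apply vdist_value in V as [_ [_ [[V _]|[V [l [L ->]]]]]]; [tauto|].
  assert (Hl : l <= c).
  { apply vle_not_lt; intro L'; apply K; right; now apply L. }
  unfold vrle; cbn; apply vle_def in Hl as [g ->].
  apply vle_def; exists g; ring.
Qed.

(** * Infinite paths and completeness *)

Definition vpath (F : sets M) : Prop :=
  (forall i, exists y, vmem (vpair i y) F) /\
  (forall i y y', vmem (vpair i y) F -> vmem (vpair i y') F -> y = y') /\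
  (forall i1 y1 i2 y2 i3 y3, vmem (vpair i1 y1) F -> vmem (vpair i2 y2) F ->
     vmem (vpair i3 y3) F -> R i1 y1 i2 y2 i3 y3).

Definition vapprox (F : sets M) n x : Prop :=
  exists a b, x = vpair (vpair a b) n /\
    forall i y, i < n -> vmem (vpair i y) F -> vbeta a b i y.

Lemma vapprox_ex (F : sets M) n : vpath F -> exists x, vapprox F n x.
Proof.
  intros [_ [HF _]].
  destruct (@vbeta_lemma (fun i y => vmem ((i + y) * (i + y) + i) F) n) as [a [b H]].
  - definability.
  - exact HF.
  - exists (vpair (vpair a b) n), a, b; split; [reflexivity | exact H].
Qed.

Lemma vapprox_beta (F : sets M) n a b :
  vpath F -> vapprox F n (vpair (vpair a b) n) ->
  forall i y, i < n -> (vbeta a b i y <-> vmem (vpair i y) F).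
Proof.
  intros [HF _] [a' [b' [E H]]] i y Hi.
  apply vpair_inj in E as [E _]; apply vpair_inj in E as [<- <-].
  split; [|now apply H].
  intro K; destruct (HF i) as [y' Hy'].
  now rewrite (vbeta_fun K (H i y' Hi Hy')).
Qed.

Lemma vapprox_node (F : sets M) n x : vpath F -> vapprox F n x -> vnode x.
Proof.
  intros HF Hx; assert (Hx' := Hx); destruct Hx' as [a [b [-> _]]].
  exists a, b, n; split; [reflexivity|].
  intros y3 i3 y2 i2 y1 i1 [H1 [K1 [H2 [K2 [H3 K3]]]]].
  rewrite (vapprox_beta HF Hx) in K1, K2, K3 by assumption.
  now apply HF.
Qed.

Lemma vapprox_agree (F : sets M) m n x y k :
  vpath F -> vapprox F m x -> vapprox F n y -> k <= m -> k <= n -> vagree x y k.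
Proof.
  intros HF Hx Hy Hm Hn.
  assert (Hx' := Hx); destruct Hx' as [a [b [-> _]]].
  assert (Hy' := Hy); destruct Hy' as [a' [b' [-> _]]].
  apply vagree_inv; split; [exact Hm|]; split; [exact Hn|].
  intros i v Hi; rewrite (vapprox_beta HF Hx), (vapprox_beta HF Hy);
    [reflexivity | | ]; eapply vlt_le_trans; eauto.
Qed.

(** Longer and longer initial segments of the path form a Cauchy sequence. A limit would have a
    fixed length n, and late terms would have to equal it or agree with it beyond n. *)
Lemma path_not_complete (F : sets M) : vpath F -> ~ vcomplete X.
Proof.
  intros HF HC.
  (* An initial segment has many codes; taking the least makes the sequence a function. *)
  destruct (@comprehension (fun z => exists n x, z = vpair n x /\
    vapprox F n x /\ forall x', x' < x -> ~ vapprox F n x')) as [S HS0].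
  { unfold vapprox, vbeta, vpair; definability. }
  assert (HS1 : forall n x, vmem (vpair n x) S <->
                 vapprox F n x /\ forall x', x' < x -> ~ vapprox F n x').
  { intros n x; rewrite HS0; split.
    - intros [n' [x' [E H]]]; apply vpair_inj in E as [-> ->]; exact H.
    - intro H; exists n, x; auto. }
  destruct (HC S) as [l [Hl HL]].
  - split; [split; [|split]|].
    + intros z Hz; apply HS0 in Hz as [n [x [E [H _]]]]; exists n, x.
      split; [|exact E]; apply vspace_node; eapply vapprox_node; eauto.
    + intro n; destruct (@least (vapprox F n)) as [x Hx].
      * unfold vapprox, vbeta, vpair; definability.
      * now apply vapprox_ex.
      * exists x; now apply HS1.
    + intros n x y [Hx Hy]; apply HS1 in Hx as [Hx Hx'], Hy as [Hy Hy'].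
      destruct (vlt_trichotomy x y) as [H|[H|H]]; [|exact H|].
      * now apply Hy' in H.
      * now apply Hx' in H.
    (* Segments of length at least c agree up to c, so the denominator serves as the modulus. *)
    + intros a b c Hc Hab; exists c; intros m n x y [Hm [Hn [Hx Hy]]].
      apply HS1 in Hx as [Hx _], Hy as [Hy _].
      apply dist_lt_of_agree; eauto using vapprox_node.
      right; eapply vapprox_agree; eauto.
  - apply vspace_node in Hl; assert (Hl' := Hl).
    apply vnode_pair in Hl' as [a [b [n E]]].
    assert (H01 : 0 < 1) by (apply vpos_succ; exists 0; ring).
    assert (Hn1 : 0 < n + 1) by (apply vpos_succ; eauto).
    destruct (HL 1 0 (n + 1) Hn1 H01) as [N HN].
    assert (K : forall m x, N <= m -> vmem (vpair m x) S -> m = n).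
    { intros m x Hm Hx; specialize (HN m x (conj Hm Hx)).
      apply HS1 in Hx as [Hx _].
      apply agree_of_dist_lt in HN; eauto using vapprox_node.
      destruct Hx as [a' [b' [Ex _]]].
      rewrite E, Ex in HN; destruct HN as [HN|HN].
      - now apply vpair_inj in HN.
      - apply vagree_inv in HN as [_ [HN _]].
        now apply vlt_le, vlt_irrefl in HN. }
    assert (KS : forall m, exists x, vmem (vpair m x) S).
    { intro m; destruct (@least (vapprox F m)) as [x Hx].
      - unfold vapprox, vbeta, vpair; definability.
      - now apply vapprox_ex.
      - exists x; now apply HS1. }
    (* This index is beyond N but differs from n, while all late terms should have length n. *)
    destruct (KS (N + (n + 1))) as [x Hx].
    apply K in Hx; [|apply vle_addr].
    assert (G : N + 1 = 0).
    { apply vadd_self with n; etransitivity; [|exact Hx]; ring. }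
    now apply succ_neq0 in G.
Qed.

(** The eventual entries of the terms of a Cauchy sequence without a limit form a path. *)
Lemma complete_of_no_path : (forall F, ~ vpath F) -> vcomplete X.
Proof.
  intros HF S [[HS1 [HS2 HS3]] HC]; apply NNPP; intro HL.
  assert (Hnode : forall n x, vmem (vpair n x) S -> vnode x).
  { intros n x H; destruct (HS1 _ H) as [n' [x' [Hx' E]]].
    apply vpair_inj in E as [_ ->]; now apply vspace_node. }
  assert (H01 : 0 < 1) by (apply vpos_succ; exists 0; ring).
  assert (HA : forall k, exists N w, forall n x,
            N <= n -> vmem (vpair n x) S -> vagree x w k).
  { intro k.
    (* As k may be 0, the bound used on distances is 1/(k + 1). *)
    assert (Hk : 0 < k + 1) by (apply vpos_succ; eauto).
    destruct (HC 1 0 (k + 1) Hk H01) as [N HN].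
    assert (HN' : forall m n x y, N <= m -> N <= n -> vmem (vpair m x) S ->
              vmem (vpair n y) S -> x = y \/ vagree x y k).
    { intros m n x y Hm Hn Hx Hy.
      specialize (HN m n x y (conj Hm (conj Hn (conj Hx Hy)))).
      apply agree_of_dist_lt in HN as [HN|HN]; eauto.
      right; eapply vagree_le; [|exact HN]; apply vle_addr. }
    destruct (HS2 N) as [w Hw]; exists N, w.
    (* The point w could be shorter than k. Then every later term has to equal w, so the sequence
       converges to w, contrary to assumption. *)
    assert (Hself : vagree w w k).
    { destruct (classic (exists n x, N <= n /\ vmem (vpair n x) S /\ x <> w))
        as [[n [x [Hn [Hx Hxw]]]]|H].
      - destruct (HN' n N x w Hn (vle_refl N) Hx Hw) as [H|H]; [tauto|].
        eapply vagree_trans; [apply vagree_sym|]; exact H.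
      - destruct HL; exists w; split; [apply vspace_node; eauto|].
        intros a b c Hc Hab; exists N; intros n x [Hn Hx].
        apply dist_lt_of_agree; eauto.
        left; apply NNPP; intro E; apply H; eauto. }
    intros n x Hn Hx; destruct (HN' n N x w Hn (vle_refl N) Hx Hw) as [->|H]; auto. }
  destruct (@comprehension (fun z => exists i y, z = vpair i y /\
    exists N, forall n x, N <= n -> vmem (vpair n x) S ->
      exists a b l, x = vpair (vpair a b) l /\ i < l /\ vbeta a b i y)) as [F HF0].
  { unfold vbeta, vpair; definability. }
  assert (HF1 : forall i y, vmem (vpair i y) F <->
    exists N, forall n x, N <= n -> vmem (vpair n x) S ->
      exists a b l, x = vpair (vpair a b) l /\ i < l /\ vbeta a b i y).
  { intros i y; rewrite HF0; split.
    - intros [i' [y' [E H]]]; apply vpair_inj in E as [-> ->]; exact H.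
    - intro H; exists i, y; auto. }
  apply (HF F); split; [|split].
  - intro i; destruct (HA (i + 1)) as [N [w H]].
    destruct (HS2 N) as [x0 Hx0].
    destruct (H N x0 (vle_refl N) Hx0) as [a0 [b0 [l0 [a [b [l [_ [Ew _]]]]]]]].
    destruct (vbeta_total a b i) as [y Hy]; exists y; apply HF1; exists N.
    intros n x Hn Hx; specialize (H n x Hn Hx).
    destruct (vnode_pair (Hnode n x Hx)) as [a' [b' [l' ->]]].
    rewrite Ew in H; apply vagree_inv in H as [H1 [_ H3]].
    exists a', b', l'; split; [reflexivity|]; split; [now apply vlt_le|].
    apply H3; [apply vlt_succ | exact Hy].
  - intros i y y' Hy Hy'; apply HF1 in Hy as [N H], Hy' as [N' H'].
    destruct (HS2 (N + N')) as [x Hx].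
    destruct (H (N + N') x) as [a [b [l [-> [_ Hy]]]]]; [apply vle_addr | exact Hx|].
    destruct (H' (N + N') (vpair (vpair a b) l)) as [a' [b' [l' [E [_ Hy']]]]];
      [apply vle_addl | exact Hx|].
    apply vpair_inj in E as [E _]; apply vpair_inj in E as [<- <-].
    eapply vbeta_fun; eauto.
  - intros i1 y1 i2 y2 i3 y3 H1 H2 H3.
    apply HF1 in H1 as [N1 H1], H2 as [N2 H2], H3 as [N3 H3].
    (* At this index all three entries are read off one term, and the node condition of that term
       applies to them. *)
    set (n := N1 + N2 + N3); destruct (HS2 n) as [x Hx].
    destruct (H1 n x) as [a [b [l [E1 [L1 B1]]]]]; [|exact Hx|].
    { apply vle_def; exists (N2 + N3); unfold n; ring. }
    destruct (H2 n x) as [a2 [b2 [l2 [E2 [L2 B2]]]]]; [|exact Hx|].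
    { apply vle_def; exists (N1 + N3); unfold n; ring. }
    destruct (H3 n x) as [a3 [b3 [l3 [E3 [L3 B3]]]]]; [|exact Hx|].
    { apply vle_addl. }
    rewrite E1 in E2, E3.
    apply vpair_inj in E2 as [E2 <-]; apply vpair_inj in E2 as [<- <-].
    apply vpair_inj in E3 as [E3 <-]; apply vpair_inj in E3 as [<- <-].
    eapply vnode_inv; eauto; rewrite <- E1; eauto.
Qed.

Theorem complete_iff_no_path : vcomplete X <-> forall F, ~ vpath F.
Proof.
  split; [|apply complete_of_no_path].
  intros H F HF; now apply (path_not_complete HF).
Qed.

End Space.

(** * Truth values along a path *)

Section Skolemization.

Fixpoint vnum (n : nat) : dom M :=
  match n with O => 0 | S n => vnum n + 1 end.

Fixpoint vtuple (d : nat) (e : nat -> dom M) : dom M :=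
  match d with
  | O => 0
  | S d => vpair (e O) (vtuple d (fun k : nat => e (S k)))
  end.

Definition vindex (d : nat) (A : form) (e : nat -> dom M) : dom M :=
  vpair (vnum (tag d A)) (vtuple d e).

Definition cat (d : nat) (e' e : nat -> dom M) : nat -> dom M :=
  fun k : nat => if k <? d then e' k else e (k - d)%nat.

Lemma cat_lt d e' e (k : nat) : (k < d)%nat -> cat d e' e k = e' k.
Proof. intro H; unfold cat; destruct (Nat.ltb_spec k d); [reflexivity | lia]. Qed.

Lemma cat_ge (d : nat) e' e (j : nat) : cat d e' e (d + j) = e j.
Proof.
  unfold cat; destruct (Nat.ltb_spec (d + j) d); [lia|].
  f_equal; lia.
Qed.

Lemma cat_succ (d : nat) e' e :
  cat (S d) e' e = cat d e' (scons (e' d) e).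
Proof.
  apply functional_extensionality; intro k; unfold cat.
  destruct (Nat.ltb_spec k (S d)), (Nat.ltb_spec k d); try lia; try reflexivity.
  - replace k with d by lia; now rewrite Nat.sub_diag.
  - now replace (k - d)%nat with (S (k - S d))%nat by lia.
Qed.

Lemma cat_scons (d : nat) x e' e :
  exists e'', (forall k : nat, (k < d)%nat -> e'' k = e' k) /\
    cat (S d) e'' e = cat d e' (scons x e).
Proof.
  exists (fun k : nat => if k =? d then x else e' k); split.
  - intros k Hk; destruct (Nat.eqb_spec k d); [lia | reflexivity].
  - rewrite cat_succ, Nat.eqb_refl.
    apply functional_extensionality; intro k; unfold cat.
    destruct (Nat.ltb_spec k d); [|reflexivity].
    destruct (Nat.eqb_spec k d); [lia | reflexivity].
Qed.

Lemma sat_allns (r : nat -> sets M) A d : forall e,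
  sat e r (allns d A) <-> forall e', sat (cat d e' e) r A.
Proof.
  induction d; intro e; cbn [allns sat].
  - assert (E : forall e', cat 0 e' e = e).
    { intro e'; apply functional_extensionality; intro k; unfold cat; cbn.
      now rewrite Nat.sub_0_r. }
    split; intro H; [intro e'; now rewrite E | rewrite <- (E e); apply H].
  - split.
    + intros H e'; rewrite cat_succ; now apply IHd.
    + intros H x; apply IHd; intro e'.
      destruct (cat_scons d x e' e) as [e'' [_ <-]]; apply H.
Qed.

Lemma vtuple_ext d : forall e e',
  (forall k : nat, (k < d)%nat -> e k = e' k) -> vtuple d e = vtuple d e'.
Proof.
  induction d; cbn; intros e e' H; [reflexivity|].
  rewrite H by lia; f_equal; apply IHd; intros; apply H; lia.
Qed.

Lemma vtuple_inj d : forall e e',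
  vtuple d e = vtuple d e' -> forall k : nat, (k < d)%nat -> e k = e' k.
Proof.
  induction d; cbn; intros e e' H k Hk; [lia|].
  apply vpair_inj in H as [H1 H2]; destruct k; [exact H1|].
  apply (IHd _ _ H2); lia.
Qed.

Lemma vnum_inj (i : nat) : forall j : nat, vnum i = vnum j -> i = j.
Proof.
  induction i; intros [|j] H; cbn in H; auto.
  - symmetry in H; now apply succ_neq0 in H.
  - now apply succ_neq0 in H.
  - f_equal; apply IHi; now apply succ_inj.
Qed.

(** Numerals of distinct natural numbers are distinct in every model, so the tag yields depth and
    formula, and unpairing yields the assignment. *)
Lemma vindex_inj d A e d' A' e' : vindex d A e = vindex d' A' e' ->
  d = d' /\ A = A' /\ forall k : nat, (k < d)%nat -> e k = e' k.
Proof.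
  intro H; apply vpair_inj in H as [H K].
  apply vnum_inj, to_nat_inj2 in H as [<- H]; apply fcode_inj in H as <-.
  repeat split; now apply vtuple_inj.
Qed.

Lemma vindex_ext d A e e' :
  (forall k : nat, (k < d)%nat -> e k = e' k) -> vindex d A e = vindex d A e'.
Proof. intro H; unfold vindex; now rewrite (vtuple_ext H). Qed.

Lemma teval_num e (n : nat) : teval e (num n) = vnum n.
Proof. induction n; cbn; congruence. Qed.

Lemma teval_tuple e d : forall b : nat,
  teval e (tuple_term d b) = vtuple d (fun k : nat => e (b + k)%nat).
Proof.
  induction d; cbn; intro b; [reflexivity|].
  rewrite IHd, Nat.add_0_r; unfold vpair.
  replace (fun k : nat => e (S b + k)%nat) with (fun k : nat => e (b + S k)%nat);
    [reflexivity|].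
  apply functional_extensionality; intro k; f_equal; lia.
Qed.

Lemma teval_index e d A : teval e (index_term d A) = vindex d A e.
Proof.
  unfold index_term, pair_term; cbn [teval].
  now rewrite teval_num, teval_tuple.
Qed.

Lemma teval_index_cat e' e d A : teval (cat d e' e) (index_term d A) = vindex d A e'.
Proof.
  rewrite teval_index; apply vindex_ext; intros k Hk; now apply cat_lt.
Qed.

Variable Z : sets M.

Definition entries i1 y1 i2 y2 i3 y3 : nat -> dom M :=
  scons i1 (scons y1 (scons i2 (scons y2 (scons i3 (scons y3 (fun _ => 0)))))).

Definition vskolem (A : form) i1 y1 i2 y2 i3 y3 : Prop :=
  sat (entries i1 y1 i2 y2 i3 y3) (fun _ => Z) (skolem A).

Lemma sat_skolem A e (r : nat -> sets M) :
  arithmetical A -> closed 0 2 A -> r O = Z ->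
  sat e r (skolem A) <->
  vskolem A (e 0%nat) (e 1%nat) (e 2%nat) (e 3%nat) (e 4%nat) (e 5%nat).
Proof.
  intros HA HA' Hr; eapply sat_closed; [now apply closed_skolem| |].
  - intros k Hk; do 6 (destruct k; [reflexivity|]); lia.
  - intros [|k] Hk; [exact Hr | lia].
Qed.

(** Set variable 0 of the matrix is X and is handled through f; the others drop by one, so that
    variable 1 becomes Z. *)
Definition vclause (d : nat) (A : form) e y1 i2 y2 i3 y3 : Prop :=
  match A with
  | fmem t O =>
      i2 = vindex 1 set_atom (fun _ => teval e t) -> (y1 = 0 <-> y2 = 0)
  | fmem t (S Y) => y1 = 0 <-> sat e (fun _ => Z) (fmem t Y)
  | fimp B C => i2 = vindex d B e -> i3 = vindex d C e ->
      (y1 = 0 <-> (y2 = 0 -> y3 = 0))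
  | alln B => forall x, i2 = vindex (S d) B (scons x e) ->
      (y1 = 0 -> y2 = 0) /\ (y1 = x + 1 -> y2 <> 0)
  | _ => y1 = 0 <-> sat e (fun _ => Z) A
  end.

Lemma sat_constraint d A i1 y1 i2 y2 i3 y3 :
  arithmetical A -> closed d 2 A ->
  sat (entries i1 y1 i2 y2 i3 y3) (fun _ => Z) (constraint d A) <->
  forall e, i1 = vindex d A e -> vclause d A e y1 i2 y2 i3 y3.
Proof.
  intros HA HA'; unfold constraint; rewrite sat_allns.
  assert (K : forall P Q : (nat -> dom M) -> Prop, (forall e, P e <-> Q e) ->
            ((forall e, P e) <-> forall e, Q e)) by firstorder.
  apply K; clear K; intro e'.
  set (e := cat d e' (entries i1 y1 i2 y2 i3 y3)).
  assert (E : forall j : nat, e (d + j)%nat = entries i1 y1 i2 y2 i3 y3 j)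
    by (intro; apply cat_ge).
  assert (Ei : forall B, teval e (index_term d B) = vindex d B e')
    by (intro; apply teval_index_cat).
  assert (Et : forall t : term, tbound d t -> teval e t = teval e' t).
  { intros t Ht; eapply teval_tbound; [exact Ht|].
    intros k Hk; now apply cat_lt. }
  assert (Ex : forall k : nat, (k < d)%nat -> e k = e' k)
    by (intros; now apply cat_lt).
  clearbody e.
  apply reflect_imp; [cbn [sat]; rewrite Ei; cbn [teval]; now rewrite E|].
  destruct A as [s t|s t|t [|Y]| |B C|B|B]; cbn [clause vclause].
  - apply reflect_iff; cbn; [now rewrite E|].
    destruct HA'; now rewrite !Et.
  - apply reflect_iff; cbn; [now rewrite E|].
    destruct HA'; now rewrite !Et.
  - apply reflect_imp; [|apply reflect_iff; cbn; now rewrite E].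
    unfold pair_term; cbn [sat teval]; rewrite teval_num, E.
    destruct HA' as [Ht _]; rewrite (Et t Ht); reflexivity.
  - apply reflect_iff; cbn; [now rewrite E|].
    destruct HA'; now rewrite !Et.
  - apply reflect_iff; cbn; [now rewrite E | reflexivity].
  - apply reflect_imp; [cbn [sat]; rewrite Ei; cbn [teval]; now rewrite E|].
    apply reflect_imp; [cbn [sat]; rewrite Ei; cbn [teval]; now rewrite E|].
    apply reflect_iff; [cbn; now rewrite E|].
    apply reflect_imp; cbn; now rewrite E.
  - apply reflect_alln; intro x.
    apply reflect_imp.
    + cbn [sat]; rewrite teval_index; cbn [teval].
      change (scons x e (S d + 2)%nat) with (e (d + 2)%nat); rewrite E.
      rewrite (vindex_ext B (d := S d) (e := scons x e) (e' := scons x e'));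
        [reflexivity|].
      intros [|k] Hk; [reflexivity|]; cbn; apply Ex; lia.
    + apply reflect_and; apply reflect_imp; try apply reflect_neg; cbn;
        now rewrite E.
  - destruct HA.
Qed.

Lemma vskolem_iff A i1 y1 i2 y2 i3 y3 :
  arithmetical A -> closed 0 2 A ->
  vskolem A i1 y1 i2 y2 i3 y3 <->
  (forall d B, In (d, B) (occurrences A) ->
     forall e, i1 = vindex d B e -> vclause d B e y1 i2 y2 i3 y3) /\
  (i1 = vindex 0 A (fun _ => 0) -> y1 <> 0).
Proof.
  intros HA HA'; unfold vskolem, skolem.
  assert (K : forall d B, In (d, B) (occurrences A) ->
            arithmetical B /\ closed d 2 B).
  { intros d B Hp; split; [eapply occurrences_arithmetical; eauto|].
    eapply occurrences_closed; eauto. }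
  induction (occurrences A) as [|[d B] l IH].
  - cbn [fold_right]; unfold falsity_constraint.
    assert (E : sat (entries i1 y1 i2 y2 i3 y3) (fun _ => Z)
        (fimp (feq (tvar 0) (index_term 0 A)) (fneg (is_zero 1)))
        <-> (i1 = vindex 0 A (fun _ => 0) -> y1 <> 0)).
    { apply reflect_imp; [|now apply reflect_neg].
      cbn [sat]; rewrite teval_index; reflexivity. }
    rewrite E; cbn; tauto.
  - cbn [fold_right fst snd]; rewrite sat_and, IH by (intros; apply K; now right).
    destruct (K d B (or_introl eq_refl)) as [HB HB'].
    rewrite sat_constraint by assumption; split.
    + intros [H1 [H2 H3]]; split; [|exact H3].
      intros d' B' [E|H]; [injection E as <- <-|]; auto.
    + intros [H1 H2]; split; [|split]; auto.
      * apply H1; now left.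
      * intros; apply H1; auto; now right.
Qed.

Definition set_env (X : sets M) : nat -> sets M := scons X (fun _ => Z).

(** ** From a path to a set *)

Section FromPath.

Variables (A : form) (F X : sets M).
Hypothesis HA : arithmetical A.
Hypothesis HA' : closed 0 2 A.
Hypothesis HF : vpath (vskolem A) F.
Hypothesis HX : forall x,
  vmem x X <-> vmem (vpair (vindex 1 set_atom (fun _ => x)) 0) F.

Lemma path_clause d B e y1 i2 y2 i3 y3 : In (d, B) (occurrences A) ->
  vmem (vpair (vindex d B e) y1) F -> vmem (vpair i2 y2) F ->
  vmem (vpair i3 y3) F -> vclause d B e y1 i2 y2 i3 y3.
Proof.
  intros HB H1 H2 H3; destruct HF as [_ [_ H]].
  specialize (H _ _ _ _ _ _ H1 H2 H3).
  apply vskolem_iff in H as [H _]; auto.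
Qed.

Lemma path_zero i y : vmem (vpair i y) F -> (vmem (vpair i 0) F <-> y = 0).
Proof.
  intro H; split; [|now intros ->].
  intro H0; destruct HF as [_ [HF' _]]; eauto.
Qed.

(** Totality of the path provides entries for the immediate subformulas, and the condition on
    triples makes the clause for [B] its truth condition. *)
Lemma path_truth B : forall d e, incl (subs d B) (occurrences A) ->
  (vmem (vpair (vindex d B e) 0) F <-> sat e (set_env X) B).
Proof.
  destruct HF as [Htot _].
  induction B as [s t|s t|t Y| |B IHB C IHC|B IHB|B IHB]; intros d e Hincl;
    assert (HB := Hincl _ (subs_self _ _));
    match goal with |- vmem (vpair ?i 0) F <-> _ =>
      destruct (Htot i) as [y Hy]; rewrite (path_zero Hy) end.
  - exact (path_clause HB Hy Hy Hy).
  - exact (path_clause HB Hy Hy Hy).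
  - destruct Y as [|Y]; [|exact (path_clause HB Hy Hy Hy)].
    destruct (Htot (vindex 1 set_atom (fun _ => teval e t))) as [y2 Hy2].
    cbn [sat set_env scons]; rewrite HX, (path_zero Hy2).
    exact (path_clause HB Hy Hy2 Hy2 eq_refl).
  - exact (path_clause HB Hy Hy Hy).
  - destruct (Htot (vindex d B e)) as [y2 Hy2], (Htot (vindex d C e)) as [y3 Hy3].
    cbn [sat].
    rewrite <- (IHB d), <- (IHC d), (path_zero Hy2), (path_zero Hy3).
    + exact (path_clause HB Hy Hy2 Hy3 eq_refl eq_refl).
    + intros p Hp; apply Hincl; right; apply in_or_app; now right.
    + intros p Hp; apply Hincl; right; apply in_or_app; now left.
  - assert (IH : forall x y2, vmem (vpair (vindex (S d) B (scons x e)) y2) F ->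
      (y2 = 0 <-> sat (scons x e) (set_env X) B)).
    { intros x y2 Hy2; rewrite <- (IHB (S d)), (path_zero Hy2); [reflexivity|].
      intros p Hp; apply Hincl; now right. }
    cbn [sat]; split.
    + intros Hy0 x.
      destruct (Htot (vindex (S d) B (scons x e))) as [y2 Hy2].
      apply (IH x y2 Hy2), (path_clause HB Hy Hy2 Hy2 x eq_refl), Hy0.
    (* A nonzero value is x + 1, and the clause at x makes x a counterexample. *)
    + intros H; destruct (zero_or_succ y) as [Hy0|[x Hx]]; [exact Hy0|].
      destruct (Htot (vindex (S d) B (scons x e))) as [y2 Hy2].
      destruct (path_clause HB Hy Hy2 Hy2 x eq_refl) as [_ K].
      destruct (K Hx); apply (IH x y2 Hy2), H.
  - destruct (occurrences_arithmetical HA HB).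
Qed.

Lemma path_false e : ~ sat e (set_env X) A.
Proof.
  intro H.
  assert (K : vmem (vpair (vindex 0 A e) 0) F).
  { apply path_truth; [apply incl_tl, incl_refl | exact H]. }
  assert (L := HF); destruct L as [_ [_ L]]; specialize (L _ _ _ _ _ _ K K K).
  apply vskolem_iff in L as [_ L]; auto; now apply L.
Qed.

End FromPath.

(** ** From a set to a path *)

Section FromSet.

Variables (A : form) (X : sets M).
Hypothesis HA : arithmetical A.
Hypothesis HA' : closed 0 2 A.

(** Requiring the least counterexample makes the value unique and arithmetically definable from X
    and Z. *)
Definition skolem_value (B : form) e y : Prop :=
  match B with
  | alln C =>
      (forall x, sat (scons x e) (set_env X) C) /\ y = 0 \/
      exists x, y = x + 1 /\ ~ sat (scons x e) (set_env X) C /\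
        forall x', x' < x -> sat (scons x' e) (set_env X) C
  | _ => sat e (set_env X) B /\ y = 0 \/ ~ sat e (set_env X) B /\ y = 1
  end.

Lemma skolem_value_zero B e y :
  skolem_value B e y -> (y = 0 <-> sat e (set_env X) B).
Proof.
  assert (H10 : vone M <> 0) by (rewrite <- (vadd0l 1); apply succ_neq0).
  assert (K : forall P : Prop, P /\ y = 0 \/ ~ P /\ y = 1 -> (y = 0 <-> P)).
  { intros P [[H ->]|[H ->]]; tauto. }
  destruct B; try exact (K _).
  intros [[H ->]|[x [-> [H _]]]]; cbn; [tauto|]; split; [|intro L; destruct H; auto].
  intro L; now apply succ_neq0 in L.
Qed.

Lemma definable_sat_scons B e :
  arithmetical B ->
  definable (fun e' : nat -> dom M => sat (scons (e' O) e) (set_env X) B).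
Proof.
  intro HB; exists B, (fun k : nat => match k with O => inl O | S k => inr (e k) end),
    (set_env X); split; [exact HB|]; intro e'.
  match goal with |- sat ?a _ _ <-> sat ?b _ _ =>
    replace a with b; [reflexivity|] end.
  now apply functional_extensionality; intros [|k].
Qed.

Lemma skolem_value_ex B e : arithmetical B -> exists y, skolem_value B e y.
Proof.
  intro HB.
  assert (K : exists y, sat e (set_env X) B /\ y = 0 \/ ~ sat e (set_env X) B /\ y = 1).
  { destruct (classic (sat e (set_env X) B)); eauto. }
  destruct B as [| | | | |B|]; try exact K; clear K.
  destruct (classic (exists x, ~ sat (scons x e) (set_env X) B)) as [H|H].
  - destruct (@least (fun x => ~ sat (scons x e) (set_env X) B)) as [x [H1 H2]].
    + now apply definable_not, definable_sat_scons.
    + exact H.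
    + exists (x + 1); right; exists x; repeat split; auto.
      intros x' Hx'; apply NNPP; auto.
  - exists 0; left; split; [|reflexivity].
    intro x; apply NNPP; eauto.
Qed.

Lemma skolem_value_fun B e y y' :
  skolem_value B e y -> skolem_value B e y' -> y = y'.
Proof.
  assert (K : forall P, P /\ y = 0 \/ ~ P /\ y = 1 ->
    P /\ y' = 0 \/ ~ P /\ y' = 1 -> y = y') by (intuition congruence).
  destruct B; try exact (K _); clear K.
  intros [[H ->]|[x [-> [H L]]]] [[H' ->]|[x' [-> [H' L']]]].
  - reflexivity.
  - destruct H'; auto.
  - destruct H; auto.
  - destruct (vlt_trichotomy x x') as [E|[->|E]]; [|reflexivity|].
    + destruct H; auto.
    + destruct H'; auto.
Qed.

Lemma skolem_value_ext d B e e' y : closed d 2 B ->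
  (forall k : nat, (k < d)%nat -> e k = e' k) ->
  skolem_value B e y -> skolem_value B e' y.
Proof.
  intros HB E.
  assert (K : forall x C, closed (S d) 2 C ->
    (sat (scons x e) (set_env X) C <-> sat (scons x e') (set_env X) C)).
  { intros x C HC; eapply sat_closed; [exact HC| |reflexivity].
    intros [|k] Hk; [reflexivity|]; apply E; lia. }
  assert (K' : forall C, closed d 2 C ->
    (sat e (set_env X) C <-> sat e' (set_env X) C)).
  { intros C HC; eapply sat_closed; [exact HC|exact E|reflexivity]. }
  destruct B; cbn [skolem_value]; try (rewrite K' by exact HB; tauto).
  intros [[H ->]|[x [-> [H L]]]]; [left|right].
  - split; [|reflexivity]; intro x; now apply K.
  - exists x; split; [reflexivity|]; split; [now rewrite <- K|].
    intros x' Hx'; now apply K, L.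
Qed.

(** The language has no quantifier over assignments, but only d values of [e'] enter, so d number
    quantifiers express it. *)
Lemma definable_cat (P : (nat -> dom M) -> Prop) d :
  definable P -> definable (fun e => exists e', P (cat d e' e)).
Proof.
  intro HP; induction d.
  - apply definable_iff with P; [exact HP|]; intro e.
    assert (E : forall e', cat 0 e' e = e).
    { intro e'; apply functional_extensionality; intro k; unfold cat; cbn.
      now rewrite Nat.sub_0_r. }
    split; [intro H; exists e; now rewrite E | intros [e' H]; now rewrite E in H].
  - apply definable_iff with
      (fun e => exists x, (fun x e => exists e', P (cat d e' (scons x e))) x e).
    + apply definable_ex.
      apply definable_iff with (1 := IHd); intro e.
      replace (scons (e O) (fun k : nat => e (S k))) with e; [reflexivity|].
      now apply functional_extensionality; intros [|k].
    + intro e; split.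
      * intros [x [e' H]]; destruct (cat_scons d x e' e) as [e'' [_ E]].
        exists e''; now rewrite E.
      * intros [e' H]; rewrite cat_succ in H; eauto.
Qed.

Lemma defterm_tuple d : forall n : nat,
  defterm (fun e : nat -> dom M => vtuple d (fun k : nat => e (n + k)%nat)).
Proof.
  induction d; intro n; cbn [vtuple]; [apply defterm_const|].
  assert (K : defterm (fun e : nat -> dom M =>
            vtuple d (fun k : nat => e (n + S k)%nat))).
  { destruct (IHd (S n)) as [t [v H]]; exists t, v; intro e; rewrite H.
    f_equal; apply functional_extensionality; intro k; f_equal; lia. }
  unfold vpair; repeat apply defterm_add; try apply defterm_mul;
    repeat apply defterm_add; try apply defterm_var; exact K.
Qed.

Lemma definable_skolem_value B (n : nat) :
  arithmetical B ->
  definable (fun e : nat -> dom M => skolem_value B e (e n)).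
Proof.
  intro HB.
  assert (S0 : forall C, arithmetical C ->
            definable (fun e : nat -> dom M => sat e (set_env X) C)).
  { intros C HC; now exists C, inl, (set_env X). }
  assert (S1 : forall C, arithmetical C ->
    definable (fun e : nat -> dom M =>
      sat (scons (e 0%nat) (fun k : nat => e (S k))) (set_env X) C)).
  { intros C HC; apply definable_iff with (1 := S0 C HC); intro e.
    replace (scons (e O) (fun k : nat => e (S k))) with e; [reflexivity|].
    now apply functional_extensionality; intros [|k]. }
  assert (S2 : forall C, arithmetical C ->
    definable (fun e : nat -> dom M =>
      sat (scons (e 0%nat) (fun k : nat => e (S (S k)))) (set_env X) C)).
  { intros C HC; apply definable_iff with
      (1 := definable_rename (fun k : nat => match k with O => O | S k => S (S k) end)
              (S0 C HC)).
    intro e.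
    replace (scons (e O) (fun k : nat => e (S (S k)))) with
      (fun k : nat => e (match k with O => O | S k => S (S k) end)); [reflexivity|].
    now apply functional_extensionality; intros [|k]. }
  assert (K : definable (fun e : nat -> dom M =>
    sat e (set_env X) B /\ e n = 0 \/ ~ sat e (set_env X) B /\ e n = 1)).
  { apply S0 in HB; definability. }
  destruct B as [| | | | |C|]; try exact K; clear K.
  cbn in HB; cbn [skolem_value]; specialize (S1 C HB); specialize (S2 C HB).
  definability.
Qed.

Definition skolem_entry (p : nat * form) i y : Prop :=
  exists e, i = vindex (fst p) (snd p) e /\ skolem_value (snd p) e y.

Lemma definable_skolem_entry (p : nat * form) :
  arithmetical (snd p) -> closed (fst p) 2 (snd p) ->
  definable (fun e : nat -> dom M => skolem_entry p (e 0%nat) (e 1%nat)).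
Proof.
  destruct p as [d B]; cbn [fst snd]; intros HB HB'.
  apply definable_iff with (fun e => exists e', (fun e : nat -> dom M =>
    e (d + 0)%nat = vindex d B e /\ skolem_value B e (e (d + 1)%nat)) (cat d e' e)).
  - apply definable_cat with (P := fun e : nat -> dom M =>
      e (d + 0)%nat = vindex d B e /\ skolem_value B e (e (d + 1)%nat)).
    apply definable_and; [|now apply definable_skolem_value].
    apply definable_eq; [assumption | apply defterm_var|].
    assert (K := defterm_tuple d 0); unfold vindex, vpair.
    repeat apply defterm_add; try apply defterm_mul; repeat apply defterm_add;
      try apply defterm_const; exact K.
  - intro e; unfold skolem_entry; cbn [fst snd].
    assert (K : forall e', (cat d e' e (d + 0)%nat = vindex d B (cat d e' e) /\
        skolem_value B (cat d e' e) (cat d e' e (d + 1)%nat)) <->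
      (e 0%nat = vindex d B e' /\ skolem_value B e' (e 1%nat))).
    { intro e'; rewrite !cat_ge.
      rewrite (vindex_ext B (d := d) (e := cat d e' e) (e' := e'))
        by (intros; now apply cat_lt).
      split; intros [H1 H2]; split; auto; revert H2;
        apply (skolem_value_ext HB'); intros k Hk; now rewrite cat_lt. }
    split; intros [e' H]; exists e'; now apply K.
Qed.

Definition skolem_graph i y : Prop :=
  exists p : nat * form, In p (occurrences A) /\ skolem_entry p i y.

(** The list of occurrences is finite outside the model, so the graph is a finite disjunction of
    definable relations. *)
Lemma definable_skolem_graph :
  definable (fun e : nat -> dom M => skolem_graph (e 0%nat) (e 1%nat)).
Proof.
  unfold skolem_graph.
  assert (K : forall p : nat * form, In p (occurrences A) ->
            arithmetical (snd p) /\ closed (fst p) 2 (snd p)).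
  { intros [d B] Hp; split; [eapply occurrences_arithmetical; eauto|].
    eapply occurrences_closed; eauto. }
  induction (occurrences A) as [|p l IH].
  - apply definable_iff with (fun _ => False); [now apply definable_false|].
    intro e; split; [tauto | now intros [p [[] _]]].
  - apply definable_iff with (fun e : nat -> dom M =>
      skolem_entry p (e 0%nat) (e 1%nat) \/
      exists p : nat * form, In p l /\ skolem_entry p (e 0%nat) (e 1%nat)).
    + apply definable_or.
      * apply definable_skolem_entry; apply K; now left.
      * apply IH; intros q Hq; apply K; now right.
    + intro e; split.
      * intros [H|[q [Hq H]]]; [exists p | exists q]; split; auto; [now left|now right].
      * intros [q [[<-|Hq] H]]; [now left | right; eauto].
Qed.

Lemma skolem_graph_index d B e y : In (d, B) (occurrences A) ->
  (skolem_graph (vindex d B e) y <-> skolem_value B e y).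
Proof.
  intro HB; split.
  - intros [[d' B'] [HB' [e' [E H]]]]; cbn [fst snd] in *.
    apply vindex_inj in E as [<- [<- E]].
    revert H; eapply skolem_value_ext; [eapply occurrences_closed; eauto|].
    intros k Hk; now rewrite E.
  - intro H; exists (d, B); split; [exact HB|]; now exists e.
Qed.

Lemma skolem_graph_fun i y y' : skolem_graph i y -> skolem_graph i y' -> y = y'.
Proof.
  intros [[d B] [HB [e [-> H]]]] H'; cbn [fst snd] in *.
  apply skolem_graph_index in H'; [|exact HB].
  eapply skolem_value_fun; eauto.
Qed.

Lemma path_of_set :
  ~ sat (fun _ => 0) (set_env X) A -> exists F, vpath (vskolem A) F.
Proof.
  intro HX.
  assert (HG := definable_skolem_graph).
  (* Positions that are not indices of subformulas get the default value 0, since a path has to be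
     total. *)
  destruct (@comprehension (fun z => exists i y, z = vpair i y /\
    (skolem_graph i y \/ y = 0 /\ ~ exists y', skolem_graph i y'))) as [F HF0].
  { unfold vpair; definability. }
  assert (HF : forall i y, vmem (vpair i y) F <->
    skolem_graph i y \/ y = 0 /\ ~ exists y', skolem_graph i y').
  { intros i y; rewrite HF0; split.
    - intros [i' [y' [E H]]]; apply vpair_inj in E as [-> ->]; exact H.
    - intro H; exists i, y; auto. }
  assert (HV : forall d B e y, In (d, B) (occurrences A) ->
    vmem (vpair (vindex d B e) y) F -> skolem_value B e y).
  { intros d B e y HB H; apply HF in H as [H|[_ H]].
    - now apply (skolem_graph_index e y HB).
    - destruct H, (@skolem_value_ex B e) as [y' H'].
      { eapply occurrences_arithmetical; eauto. }
      exists y'; now apply (skolem_graph_index e y' HB). }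
  exists F; split; [|split].
  - intro i; destruct (classic (exists y, skolem_graph i y)) as [[y H]|H].
    + exists y; apply HF; now left.
    + exists 0; apply HF; now right.
  - intros i y y' H H'; apply HF in H, H'.
    destruct H as [H|[-> H]], H' as [H'|[-> H']]; try reflexivity.
    + eapply skolem_graph_fun; eauto.
    + destruct H'; eauto.
    + destruct H; eauto.
  - intros i1 y1 i2 y2 i3 y3 H1 H2 H3; apply vskolem_iff; auto; split.
    + intros d B HB e ->; apply HV in H1; [|exact HB].
      assert (HS' := occurrences_sub HB).
      assert (Hz := skolem_value_zero H1).
      destruct B as [s t|s t|t [|Y]| |B C|B|B]; cbn [vclause]; try exact Hz.
      * intros ->.
        change (vindex 1 set_atom (fun _ => teval e t)) with
          (vindex 1 set_atom (scons (teval e t) e)) in H2.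
        apply HV in H2; [|now left].
        rewrite Hz, (skolem_value_zero H2); reflexivity.
      * intros -> ->; apply HV in H2, H3.
        -- rewrite Hz, (skolem_value_zero H2), (skolem_value_zero H3); reflexivity.
        -- apply HS'; right; apply in_or_app; right; apply subs_self.
        -- apply HS'; right; apply in_or_app; left; apply subs_self.
      * intros x ->; apply HV in H2; [|apply HS'; right; apply subs_self].
        apply skolem_value_zero in H2; rewrite H2, Hz; split; [intro H; apply H|].
        intros E H; destruct H1 as [[_ H1]|[x' [E' [H1 _]]]].
        -- rewrite E in H1; now apply succ_neq0 in H1.
        -- rewrite E in E'; apply succ_inj in E' as <-; now apply H1.
      * destruct (occurrences_arithmetical HA HB).
    + intros -> E; apply HV in H1; [|right; apply subs_self].
      apply HX, (skolem_value_zero H1), E.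
Qed.

End FromSet.

Theorem path_iff_set A : arithmetical A -> closed 0 2 A ->
  (exists F, vpath (vskolem A) F) <->
  exists X, ~ sat (fun _ => 0) (set_env X) A.
Proof.
  intros HA HA'; split.
  - intros [F HF].
    destruct (@comprehension (fun x =>
      vmem (vpair (vindex 1 set_atom (fun _ => x)) 0) F)) as [X HX].
    { unfold vindex, vpair; cbn [vtuple]; unfold vpair; definability. }
    exists X; eapply path_false; eauto.
  - intros [X HX]; now apply (path_of_set HA HA' (X := X)).
Qed.

End Skolemization.

End Arithmetic.

(** * Universality *)

Definition alls_body (A : form) : form :=
  match A with alls B => B | _ => A end.

(** The metric axioms are arithmetical, so they can be moved under the set quantifier of
    completeness. *)
Lemma complete_space_Pi11 :
  exists Q, Pi11 Q /\ closed 0 1 Q /\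
    provable ACA0 (alls (fiff (fand countable_metric_space complete) Q)).
Proof.
  exists (alls (fand (shifts countable_metric_space) (alls_body complete))).
  split; [|split].
  - eexists; split; [|reflexivity].
    split; [|exact I]; split; [|split; [|exact I]].
    + apply arithmetical_subst, arithmetical_countable_metric_space.
    + cbv; repeat split.
  - split; [|exact I]; split; [|split; [|exact I]].
    + cbv; repeat split; auto 60 with arith.
    + exact closed_complete.
  - apply (completeness ACA0_subst_stable); intros M [S0] HM e r X.
    rewrite sat_iff, sat_and.
    change (sat e (scons X r) complete) with
      (forall S, sat e (scons S (scons X r)) (alls_body complete)).
    cbn [sat].
    assert (K : forall S, sat e (scons S (scons X r))
        (fand (shifts countable_metric_space) (alls_body complete)) <->
      sat e (scons X r) countable_metric_space /\
      sat e (scons S (scons X r)) (alls_body complete)).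
    { intro S; now rewrite sat_and, sat_shifts. }
    split.
    + intros [H1 H2] S; apply K; auto.
    (* Some set [S0] is required to get the metric axioms back out of the scope of the set
       quantifier. *)
    + intro H; split; [apply (K S0), H|]; intro S; apply (K S), H.
Qed.

Theorem proposition12p9 : Pi11_universal countable_metric_space complete.
Proof.
  split; [exact complete_space_Pi11|].
  intros A [B [HB ->]] HA; cbn [closed] in HA.
  exists (space_form (skolem B)); split; [|split].
  - now apply arithmetical_space_form, arithmetical_skolem.
  - now apply closed_space_form, closed_skolem.
  - apply (completeness ACA0_subst_stable); intros M HS HM e r Z.
    rewrite sat_exs.
    (* The code of the space exists by comprehension, with Z as a parameter. *)
    assert (C := aca_comprehension
      (arithmetical_space_form (arithmetical_skolem HB))).
    apply (@HM _ e (scons Z r)) in C.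
    rewrite sat_exs in C; destruct C as [X HX]; exists X.
    rewrite !sat_and; split; [exact HX|].
    assert (HX' : forall w, vmem w X <-> vspace_elt (vskolem Z B) w).
    { intro w; specialize (HX w); rewrite sat_iff, sat_shifts in HX.
      cbn [sat teval scons] in HX; rewrite HX.
      apply (@sat_space_form M (vskolem Z B) _ (scons w e) (scons Z r)).
      intro e'; now apply sat_skolem. }
    split.
    + apply sat_countable_metric_space; exact (metric_space_nodes HS HM HX').
    + rewrite sat_iff, sat_shifts, sat_complete; cbn [scons].
      rewrite (complete_iff_no_path HS HM HX'); cbn [sat].
      assert (E : forall Y, sat e (scons Y (scons Z r)) B <->
                sat (fun _ => vzero M) (set_env Z Y) B).
      { intro Y; eapply sat_closed; [exact HA | intros; lia|].
        intros [|[|k]] Hk; [reflexivity|reflexivity|lia]. }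
      (* Paths and sets that falsify the matrix exist together, so the absence of paths says that
         every set satisfies it. *)
      assert (K := path_iff_set HS HM Z HB HA).
      split.
      * intros H F HF; destruct (proj1 K (ex_intro _ F HF)) as [Y HY].
        apply HY, E, H.
      * intros H Y; apply E, NNPP; intro HY.
        destruct (proj2 K (ex_intro _ Y HY)) as [F HF]; exact (H F HF).
Qed.
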